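(* Let $d\ge2$ be an integer and $q$ a prime power. For $T\ge1$ put $E_T=\{x\in Y:\alpha(x)>T\}$. There exist constants $0<A_1\le A_2<\infty$, depending only on $d$ and $q$, such that $$A_1T^{-d}\le\nu(E_T)\le A_2T^{-d}\qquad(T\ge1).$$ The same estimate holds for the probability measure $\mu=\nu/\nu(Y)$ after multiplying the constants by $\nu(Y)^{-1}$.
   Context: Let $q$ be a prime power, $d\ge2$ an integer, $F=\mathbb F_q(\!(t^{-1})\!)$ with valuation ring $\mathcal O=\mathbb F_q[\![t^{-1}]\!]$ and absolute value normalized by $|t|=q$. Put $G=\operatorname{PGL}_d(F)$, $K=\operatorname{PGL}_d(\mathcal O)$, $\Gamma=\operatorname{PGL}_d(\mathbb F_q[t])$. Haar measure on $G$ is normalized by $\operatorname{vol}(K)=1$. Put $Y=\Gamma\backslash G/K$ (a countable set), and let $\nu$ be the measure on $Y$ induced from the Haar measure of $G$, i.e. the push-forward to $Y$ of the quotient measure on $\Gamma\backslash G$; equivalently each point $\Gamma gK$ has mass $1/|\Gamma\cap gKg^{-1}|$. The total mass $\nu(Y)$ is finite, and $\mu=\nu/\nu(Y)$. Height function $\alpha$. Let $\Lambda_0=\mathbb F_q[t]^d\subset F^d$. Use the max norm on $F^d$ and on each $\bigwedge^jF^d$ the sup norm in the standard exterior basis. For a rank-$d$ $\mathbb F_q[t]$-lattice $\Lambda=g\Lambda_0$, $g\in\operatorname{GL}_d(F)$, put $\operatorname{covol}(\Lambda)=|\det g|$. For the homothety class $[\Lambda]$ define $$\alpha([\Lambda])=\max_{1\le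 j\le d}\left\{\operatorname{covol}(\Lambda)^{j/d}\,\|v_1\wedge\cdots\wedge v_j\|^{-1}: v_1,\ldots,v_j\in\Lambda\text{ are $F$-linearly independent}\right\}.$$ This is invariant under homotheties. On $Y$ define $\alpha(\Gamma gK)=\alpha([g^{-1}\Lambda_0])$, which is well-defined because $K$ acts by isometries and $\Gamma$ preserves $[\Lambda_0]$. *)

(* Defs.v *)
From HB Require Import structures.
From mathcomp Require Import zify.
From mathcomp Require Import all_boot all_order all_algebra fraction generic_quotient.
From mathcomp Require Import monoid finmap.
From mathcomp Require Import all_classical all_reals all_analysis.

Set Implicit Arguments.
Unset Strict Implicit.
Unset Printing Implicit Defensive.

Import Order.TTheory GRing.Theory Num.Theory.
Local Open Scope classical_set_scope.
Local Open Scope ring_scope.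
Local Open Scope quotient_scope.

Record power_series (k : Type) := PSeries { pscoef : nat -> k }.

HB.instance Definition _ (k : Type) := [isNew for @pscoef k].
HB.instance Definition _ (k : choiceType) := [Choice of power_series k by <:].

Section PowerSeries.
Variable k : fieldType.
Implicit Types a b c : power_series k.

Lemma power_seriesP a b : (forall n, pscoef a n = pscoef b n) -> a = b.
Proof. by move=> h; apply: val_inj; apply/funext. Qed.

Definition ps_add a b := PSeries (fun n => pscoef a n + pscoef b n).
Definition ps_opp a := PSeries (fun n => - pscoef a n).
Definition ps_const (x : k) := PSeries (fun n => if n == 0%N then x else 0).
Definition ps_mul a b :=
  PSeries (fun n => \sum_(i < n.+1) pscoef a i * pscoef b (n - i)).

Fact ps_addA : associative ps_add.
Proof. by move=> a b c; apply: power_seriesP => n /=; rewrite addrA. Qed.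
Fact ps_addC : commutative ps_add.
Proof. by move=> a b; apply: power_seriesP => n /=; rewrite addrC. Qed.
Fact ps_add0 : left_id (ps_const 0) ps_add.
Proof. by move=> a; apply: power_seriesP => n /=; rewrite if_same add0r. Qed.
Fact ps_addN : left_inverse (ps_const 0) ps_opp ps_add.
Proof. by move=> a; apply: power_seriesP => n /=; rewrite addNr if_same. Qed.

HB.instance Definition _ :=
  GRing.isZmodule.Build (power_series k) ps_addA ps_addC ps_add0 ps_addN.

Let trunc N a : {poly k} := \poly_(i < N.+1) pscoef a i.

Let coef_trunc N a i : (i <= N)%N -> (trunc N a)`_i = pscoef a i.
Proof. by move=> le_iN; rewrite coef_poly ltnS le_iN. Qed.

Let ps_mul_trunc N a b i : (i <= N)%N ->
  pscoef (ps_mul a b) i = (trunc N a * trunc N b)`_i.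
Proof.
move=> le_iN; rewrite coefM /=; apply: eq_bigr => -[j /=]; rewrite ltnS => le_ji _.
by rewrite !coef_trunc // (leq_trans _ le_iN) // leq_subr.
Qed.

Fact ps_mulC : commutative ps_mul.
Proof.
by move=> a b; apply: power_seriesP => n; rewrite !(@ps_mul_trunc n) // mulrC.
Qed.

Fact ps_mulA : associative ps_mul.
Proof.
have coef3 a b c n : pscoef (ps_mul (ps_mul a b) c) n =
    (trunc n a * trunc n b * trunc n c)`_n.
  rewrite coefM; apply: eq_bigr => -[j lt_jn] _; have le_jn : (j <= n)%N by [].
  by rewrite [RHS]/= -ps_mul_trunc // coef_trunc ?leq_subr.
move=> a b c; apply: power_seriesP => n.
by rewrite (ps_mulC a) !coef3 (mulrC _ (trunc n a)) mulrA.
Qed.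

Fact ps_mul1 : left_id (ps_const 1) ps_mul.
Proof.
move=> a; apply: power_seriesP => n /=; rewrite big_ord_recl /= mul1r subn0.
by rewrite big1 ?addr0 // => i _; rewrite mul0r.
Qed.

Fact ps_mulDl : left_distributive ps_mul ps_add.
Proof.
move=> a b c; apply: power_seriesP => n /=; rewrite -big_split /=.
by apply: eq_bigr => i _; rewrite mulrDl.
Qed.

Fact ps_one_neq0 : ps_const 1 != 0.
Proof.
by apply/eqP => /(congr1 (fun a => pscoef a 0)) /= /eqP; rewrite oner_eq0.
Qed.

HB.instance Definition _ := GRing.Zmodule_isComNzRing.Build (power_series k)
  ps_mulA ps_mulC ps_mul1 ps_mulDl ps_one_neq0.

Definition ps_unit : pred (power_series k) := fun a => `[< exists b, b * a = 1 >].
Definition ps_inv a : power_series k :=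
  if pselect (exists b, b * a = 1) is left h then projT1 (cid h) else a.

Fact ps_mulV : {in ps_unit, left_inverse 1 ps_inv *%R}.
Proof.
move=> a /asboolP h; rewrite /ps_inv; case: pselect => // h'.
by case: (cid h').
Qed.
Fact ps_unitP a b : b * a = 1 -> ps_unit a.
Proof. by move=> h; apply/asboolP; exists b. Qed.
Fact ps_inv_out : {in [predC ps_unit], ps_inv =1 id}.
Proof.
move=> a; rewrite inE => /asboolP na; rewrite /ps_inv.
by case: pselect.
Qed.

HB.instance Definition _ := GRing.ComNzRing_hasMulInverse.Build (power_series k)
  ps_mulV ps_unitP ps_inv_out.

Lemma power_series_neq0 a : a != 0 -> exists n, pscoef a n != 0.
Proof.
move=> a0; apply: contrapT => h; case/negP: a0; apply/eqP/power_seriesP => n /=.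
by rewrite if_same; apply/eqP; apply: contrapT => /negP an; apply: h; exists n.
Qed.

(** Order of vanishing; the value at [0] is a dummy. *)
Definition ps_ord a : nat :=
  if pselect (exists n, pscoef a n != 0) is left h then ex_minn h else 0%N.

Lemma ps_ordP a : a != 0 ->
  pscoef a (ps_ord a) != 0 /\ (forall i, (i < ps_ord a)%N -> pscoef a i = 0).
Proof.
move=> /power_series_neq0 h; rewrite /ps_ord; case: pselect => // h'.
case: ex_minnP => n n0 nmin; split=> // i lt_in; apply/eqP/negP => /negP i0.
by have := nmin i i0; rewrite leqNgt lt_in.
Qed.

Lemma ps_ord_eq a n : pscoef a n != 0 ->
  (forall i, (i < n)%N -> pscoef a i = 0) -> ps_ord a = n.
Proof.
move=> an0 amin.
have a0 : a != 0.
  by apply: contraNneq an0 => ->; rewrite /= if_same.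
have [h1 h2] := ps_ordP a0.
case: (ltngtP (ps_ord a) n) => // [/amin|/h2] e; first by rewrite e eqxx in h1.
by rewrite e eqxx in an0.
Qed.

Lemma ps_ordM_subproof a b : a != 0 -> b != 0 ->
  pscoef (a * b) (ps_ord a + ps_ord b) != 0 /\
  (forall i, (i < ps_ord a + ps_ord b)%N -> pscoef (a * b) i = 0).
Proof.
move=> /ps_ordP[a1 a2] /ps_ordP[b1 b2]; split.
  have lt_a : (ps_ord a < (ps_ord a + ps_ord b).+1)%N by rewrite ltnS leq_addr.
  rewrite /= (bigD1 (Ordinal lt_a)) //= addKn big1 ?addr0 ?mulf_neq0 //.
  move=> i /eqP ia; case: (ltngtP i (ps_ord a)) => [/a2->|lt_ai|e].
  - by rewrite mul0r.
  - by rewrite [X in _ * X]b2 ?mulr0 //; have := ltn_ord i; lia.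
  - by case: ia; apply: val_inj.
move=> n lt_n /=; apply: big1 => -[i /= lt_in] _.
case: (ltnP i (ps_ord a)) => [/a2->|le_ai]; first by rewrite mul0r.
by rewrite b2 ?mulr0 //; lia.
Qed.

Fact ps_integral a b : a * b = 0 -> (a == 0) || (b == 0).
Proof.
move=> ab0; apply/norP => -[a0 b0].
by have [+ _] := ps_ordM_subproof a0 b0; rewrite ab0 /= if_same eqxx.
Qed.

HB.instance Definition _ :=
  GRing.ComUnitRing_isIntegral.Build (power_series k) ps_integral.

Lemma ps_ordM a b : a != 0 -> b != 0 -> ps_ord (a * b) = (ps_ord a + ps_ord b)%N.
Proof. by move=> a0 b0; have [] := ps_ordM_subproof a0 b0; apply: ps_ord_eq. Qed.

Fact ps_const_zmod_morphism : zmod_morphism ps_const.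
Proof.
by move=> x y; apply: power_seriesP => n /=; case: ifP; rewrite ?subrr.
Qed.
Fact ps_const_monoid_morphism : monoid_morphism ps_const.
Proof.
split=> // x y; apply: power_seriesP => n /=; rewrite big_ord_recl /= subn0 big1.
  by rewrite addr0; case: ifP; rewrite ?mulr0.
by move=> i _; rewrite mul0r.
Qed.
HB.instance Definition _ := GRing.isZmodMorphism.Build k (power_series k) ps_const
  ps_const_zmod_morphism.
HB.instance Definition _ := GRing.isMonoidMorphism.Build k (power_series k) ps_const
  ps_const_monoid_morphism.

Definition ps_var : power_series k := PSeries (fun n => (n == 1%N)%:R).

End PowerSeries.

(** With [ps_var] playing the role of $t^{-1}$, [power_series k] is $k[[t^{-1}]]$
    and its fraction field [laurent k] is $k((t^{-1}))$. *)
Notation laurent k := {fraction (power_series k)}.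

Section Laurent.
Variable k : fieldType.

Definition lconst : k -> laurent k := @FracField.tofrac (power_series k) \o @ps_const k.
HB.instance Definition _ := GRing.RMorphism.on lconst.

Definition tvar : laurent k := (FracField.tofrac (ps_var k))^-1.

Definition poly_laurent : {poly k} -> laurent k :=
  horner_morph (fun x => mulrC tvar (lconst x)).
HB.instance Definition _ := GRing.RMorphism.on poly_laurent.

Definition power_series_laurent : power_series k -> laurent k :=
  @FracField.tofrac (power_series k).
HB.instance Definition _ := GRing.RMorphism.on power_series_laurent.

End Laurent.

(** [#|k|] to the power [ord b - ord a] for [x = a / b]; see [labs_frac]. *)
Definition labs (R : realType) (k : finFieldType) (x : laurent k) : R :=
  if x == 0 then 0
  else (#|k|%:R : R) ^ ((ps_ord (repr x).2)%:Z - (ps_ord (repr x).1)%:Z).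

Section Labs.
Variables (R : realType) (k : finFieldType).

Lemma labs_frac (a b : power_series k) : a != 0 -> b != 0 ->
  labs R (power_series_laurent a / power_series_laurent b) =
  (#|k|%:R : R) ^ ((ps_ord b)%:Z - (ps_ord a)%:Z).
Proof.
move=> a0 b0; set x := _ / _.
have x0 : x != 0 by rewrite mulf_neq0 ?invr_neq0 ?tofrac_eq0.
rewrite /labs (negPf x0); set n := (repr x).1; set e := (repr x).2.
have e0 : e != 0 by apply: denom_ratioP.
have xE : x = power_series_laurent n / power_series_laurent e.
  rewrite /n /e -[x in LHS]reprK -[repr x in LHS]Ratio_numden.
  rewrite /power_series_laurent; unlock FracField.tofrac.
  rewrite -[(_ (Ratio e 1))^-1]FracField.pi_inv -[RHS]FracField.pi_mul.
  congr (\pi _); rewrite /FracField.mulf /FracField.invf.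
  by rewrite !numden_Ratio ?oner_neq0 // mulr1 mul1r.
have n0 : n != 0.
  by apply: contra_neq x0 => n0; rewrite xE n0 rmorph0 mul0r.
have : power_series_laurent (a * e) = power_series_laurent (n * b).
  rewrite !rmorphM; apply/eqP.
  by rewrite -eqr_div ?tofrac_eq0 // -/x xE.
move=> /eqP; rewrite tofrac_eq => /eqP /(congr1 (@ps_ord k)).
by rewrite !ps_ordM // => h; congr (_ ^ _); lia.
Qed.

Lemma labs_tvar : labs R (tvar k) = #|k|%:R.
Proof.
have ord_var : ps_ord (ps_var k) = 1%N.
  by apply: ps_ord_eq => [|[]] //=; rewrite oner_neq0.
have ord_one : ps_ord (1 : power_series k) = 0%N.
  by apply: ps_ord_eq => //=; rewrite oner_neq0.
have var0 : ps_var k != 0.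
  apply/eqP => /(congr1 (fun a => pscoef a 1)) /= /eqP.
  by rewrite oner_eq0.
have -> : tvar k = power_series_laurent (1 : power_series k) / power_series_laurent (ps_var k).
  by rewrite rmorph1 mul1r.
by rewrite labs_frac ?oner_neq0 // ord_var ord_one subr0 expr1z.
Qed.

End Labs.

Record GL (F : fieldType) (d : nat) :=
  MkGL { GLmx :> 'M[F]_d; GL_unit : GLmx \in unitmx }.
HB.instance Definition _ (F : fieldType) (d : nat) := [isSub for @GLmx F d].
HB.instance Definition _ (F : fieldType) (d : nat) := [Choice of GL F d by <:].

Section PGL.
Variables (F : fieldType) (d : nat).

Fact GL_one_subproof : (1%:M : 'M[F]_d) \in unitmx.
Proof. exact: unitmx1. Qed.
Fact GL_mul_subproof (A B : GL F d) : (A *m B) \in unitmx.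
Proof. by rewrite unitmx_mul !GL_unit. Qed.
Fact GL_inv_subproof (A : GL F d) : invmx A \in unitmx.
Proof. by rewrite unitmx_inv GL_unit. Qed.

Definition GL_one := MkGL GL_one_subproof.
Definition GL_mul (A B : GL F d) := MkGL (GL_mul_subproof A B).
Definition GL_inv (A : GL F d) := MkGL (GL_inv_subproof A).

Fact GL_mulA : associative GL_mul.
Proof. by move=> A B C; apply: val_inj; rewrite /= mulmxA. Qed.
Fact GL_mul1 : left_id GL_one GL_mul.
Proof. by move=> A; apply: val_inj; rewrite /= mul1mx. Qed.
Fact GL_1mul : right_id GL_one GL_mul.
Proof. by move=> A; apply: val_inj; rewrite /= mulmx1. Qed.
Fact GL_mulV : left_inverse GL_one GL_inv GL_mul.
Proof. by move=> A; apply: val_inj; rewrite /= mulVmx ?GL_unit. Qed.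
Fact GL_Vmul : right_inverse GL_one GL_inv GL_mul.
Proof. by move=> A; apply: val_inj; rewrite /= mulmxV ?GL_unit. Qed.

HB.instance Definition _ :=
  isGroup.Build (GL F d) GL_mulA GL_mul1 GL_1mul GL_mulV GL_Vmul.

Definition homothetic : rel (GL F d) := fun A B =>
  `[< exists2 c : F, c != 0 & GLmx A = c *: GLmx B >].

Fact homothetic_refl : reflexive homothetic.
Proof. by move=> A; apply/asboolP; exists 1; rewrite ?oner_neq0 ?scale1r. Qed.

Fact homothetic_sym : symmetric homothetic.
Proof.
have h A B : homothetic A B -> homothetic B A.
  move=> /asboolP[c c0 e]; apply/asboolP; exists c^-1; first by rewrite invr_neq0.
  by rewrite e scalerA mulVf // scale1r.
by move=> A B; apply/idP/idP; apply: h.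
Qed.

Fact homothetic_trans : transitive homothetic.
Proof.
move=> B A C /asboolP[c c0 e] /asboolP[c' c'0 e']; apply/asboolP.
by exists (c * c'); rewrite ?mulf_neq0 // e e' scalerA.
Qed.

Canonical homothetic_equiv :=
  EquivRel homothetic homothetic_refl homothetic_sym homothetic_trans.

Definition PGL := {eq_quot homothetic}.
HB.instance Definition _ : EqQuotient _ homothetic PGL := EqQuotient.on PGL.
HB.instance Definition _ := Choice.on PGL.

Definition PGL_one : PGL := \pi_PGL (1%g : GL F d).
Definition PGL_mul := lift_op2 PGL (fun A B : GL F d => (A * B)%g).
Definition PGL_inv := lift_op1 PGL (fun A : GL F d => (A^-1)%g).

Fact pi_PGL_mul : {morph \pi_PGL : A B / (A * B)%g >-> PGL_mul A B}.
Proof.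
move=> A B; unlock PGL_mul; apply/eqmodP => /=.
have /eqmodP /asboolP[c c0 e] : \pi_PGL A = \pi_PGL (repr (\pi_PGL A)) by rewrite reprK.
have /eqmodP /asboolP[c' c'0 e'] : \pi_PGL B = \pi_PGL (repr (\pi_PGL B)) by rewrite reprK.
apply/asboolP; exists (c * c'); rewrite ?mulf_neq0 //.
by rewrite /= e e' -scalemxAl -scalemxAr scalerA.
Qed.
Canonical pi_PGL_mul_morph := PiMorph2 pi_PGL_mul.

Fact pi_PGL_inv : {morph \pi_PGL : A / (A^-1)%g >-> PGL_inv A}.
Proof.
move=> A; unlock PGL_inv; apply/eqmodP => /=.
have /eqmodP /asboolP[c c0 e] : \pi_PGL A = \pi_PGL (repr (\pi_PGL A)) by rewrite reprK.
apply/asboolP; exists c^-1; rewrite ?invr_neq0 //=.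
by rewrite e invmxZ // unitmxZ ?unitfE ?GL_unit.
Qed.
Canonical pi_PGL_inv_morph := PiMorph1 pi_PGL_inv.

Fact PGL_mulA : associative PGL_mul.
Proof.
by elim/quotW=> x; elim/quotW=> y; elim/quotW=> z; rewrite !piE mulgA.
Qed.
Fact PGL_mul1 : left_id PGL_one PGL_mul.
Proof. by elim/quotW=> x; rewrite /PGL_one !piE mul1g. Qed.
Fact PGL_1mul : right_id PGL_one PGL_mul.
Proof. by elim/quotW=> x; rewrite /PGL_one !piE mulg1. Qed.
Fact PGL_mulV : left_inverse PGL_one PGL_inv PGL_mul.
Proof. by elim/quotW=> x; rewrite /PGL_one !piE mulVg. Qed.
Fact PGL_Vmul : right_inverse PGL_one PGL_inv PGL_mul.
Proof. by elim/quotW=> x; rewrite /PGL_one !piE mulgV. Qed.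

HB.instance Definition _ :=
  isGroup.Build PGL PGL_mulA PGL_mul1 PGL_1mul PGL_mulV PGL_Vmul.

Lemma piM (A B : GL F d) : \pi_PGL (A * B)%g = (\pi_PGL A * \pi_PGL B)%g.
Proof. exact: pi_PGL_mul. Qed.
Lemma piV (A : GL F d) : \pi_PGL (A^-1)%g = ((\pi_PGL A)^-1)%g.
Proof. exact: pi_PGL_inv. Qed.

(** The image of $GL_d(S)$ in $PGL_d(F)$. It is $PGL_d(S)$ when $f$ is injective
    and every rank one projective $S$-module is free, as for the rings
    $k[t]$ and $k[[t^{-1}]]$. *)
Definition PGL_image (S : comUnitRingType) (f : {rmorphism S -> F}) : set PGL :=
  [set x | exists (A : GL F d) (B : 'M[S]_d),
    [/\ x = \pi_PGL A, B \in unitmx & GLmx A = map_mx f B]].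

Section Image.
Variables (S : comUnitRingType) (f : {rmorphism S -> F}).

Lemma PGL_image1 : PGL_image f 1%g.
Proof. by exists 1%g, 1%:M; rewrite unitmx1 map_mx1. Qed.

Lemma PGL_imageM x y : PGL_image f x -> PGL_image f y -> PGL_image f (x * y)%g.
Proof.
move=> [A [B [-> Bu e]]] [A' [B' [-> Bu' e']]].
by exists (A * A')%g, (B *m B'); rewrite piM unitmx_mul Bu Bu' map_mxM /= e e'.
Qed.

Lemma PGL_imageV x : PGL_image f x -> PGL_image f (x^-1)%g.
Proof.
move=> [A [B [-> Bu e]]]; exists (A^-1)%g, (invmx B).
split; rewrite ?piV ?unitmx_inv //=; apply: (can_inj (mulmxK (GL_unit A))).
by rewrite mulVmx ?GL_unit // e -map_mxM mulVmx // map_mx1.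
Qed.

End Image.

End PGL.

Arguments PGL_image {F} d {S} f.

Section Height.
Variables (k : finFieldType) (d : nat).
Local Notation F := (laurent k).
Local Notation G := (PGL F d).

Definition Kgrp : set G := PGL_image d (@power_series_laurent k).
Definition Gamma : set G := PGL_image d (@poly_laurent k).

Definition dcoset_rel : rel G := fun x y =>
  `[< exists a b, [/\ Gamma a, Kgrp b & y = (a * x * b)%g] >].

Fact dcoset_refl : reflexive dcoset_rel.
Proof.
move=> x; apply/asboolP; exists 1%g, 1%g.
by split; [exact: PGL_image1|exact: PGL_image1|rewrite mul1g mulg1].
Qed.

Fact dcoset_sym : symmetric dcoset_rel.
Proof.
have h x y : dcoset_rel x y -> dcoset_rel y x.
  move=> /asboolP[a [b [ha hb ->]]]; apply/asboolP; exists (a^-1)%g, (b^-1)%g.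
  by split; [exact: PGL_imageV|exact: PGL_imageV|rewrite !mulgA mulVg mul1g mulgK].
by move=> x y; apply/idP/idP; apply: h.
Qed.

Fact dcoset_trans : transitive dcoset_rel.
Proof.
move=> y x z /asboolP[a [b [ha hb ->]]] /asboolP[a' [b' [ha' hb' ->]]].
apply/asboolP; exists (a' * a)%g, (b * b')%g.
by split; [exact: PGL_imageM|exact: PGL_imageM|rewrite !mulgA].
Qed.

Canonical dcoset_equiv :=
  EquivRel dcoset_rel dcoset_refl dcoset_sym dcoset_trans.

Definition Y := {eq_quot dcoset_rel}.
HB.instance Definition _ : EqQuotient _ dcoset_rel Y := EqQuotient.on Y.
HB.instance Definition _ := Choice.on Y.

Definition stab (g : G) : set G :=
  Gamma `&` [set (g * x * g^-1)%g | x in Kgrp].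

Variable R : realType.

(** The push-forward to $Y$ of the quotient of the Haar measure normalized by
    $vol(K) = 1$: each point $\Gamma g K$ has mass $1/|\Gamma\cap gKg^{-1}|$.
    These stabilizers are finite; the junk value for an infinite one would be
    $0^{-1} = 0$. *)
Definition nu (E : set Y) : \bar R :=
  \esum_(y in E) ((#|` fset_set (stab (repr y))|%:R^-1 : R)%:E).

Definition mu (E : set Y) : \bar R := (nu E / nu [set: Y])%E.

Definition lattice (g : GL F d) : set 'cV[F]_d :=
  [set g *m map_mx (@poly_laurent k) w | w in [set: 'cV[{poly k}]_d]].

(** For $v_1,\dots,v_j$ the columns of $V$, the coordinate of
    $v_1\wedge\dots\wedge v_j$ on $e_{f(1)}\wedge\dots\wedge e_{f(j)}$ is the
    minor of $V$ on the rows $f(1) < \dots < f(j)$. *)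
Definition wedge_norm (j : nat) (V : 'M[F]_(d, j)) : R :=
  \big[Num.max/0]_(f : {ffun 'I_j -> 'I_d} |
      [forall a : 'I_j, forall b : 'I_j, (a < b)%N ==> (f a < f b)%N])
    labs R (\det (rowsub f V)).

Definition covol (g : GL F d) : R := labs R (\det g).

(** The height of $[g\Lambda_0]$. The maximum is written as a supremum in the
    extended reals, so that it needs no convention for unbounded sets. *)
Definition height (g : GL F d) : \bar R :=
  ereal_sup [set h : \bar R | exists (j : nat) (V : 'M[F]_(d, j)),
    [/\ (1 <= j <= d)%N,
        (forall i : 'I_j, lattice g (col i V)),
        row_free V^T &
        h = ((covol g `^ (j%:R / d%:R) / wedge_norm V)%:E)]].

(** $\alpha(\Gamma g K) = \alpha([g^{-1}\Lambda_0])$, which does not depend on the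
    chosen representative $g$. *)
Definition alpha (y : Y) : \bar R := height (repr (repr y : G))^-1%g.

Definition superlevel (T : R) : set Y := [set y | (T%:E < alpha y)%E].

End Height.

Arguments superlevel k d {R} T.

(* Main.v *)
From HB Require Import structures.
Require Import Defs.
From mathcomp Require Import zify ring lra.
From mathcomp Require Import all_boot all_order all_fingroup all_algebra fraction generic_quotient.
From mathcomp Require Import monoid finmap.
From mathcomp Require Import all_classical all_reals all_analysis.

(** Every double coset has a representative [diag(s^b_i)] with [s = t^-1] and
    [0 = b_0 <= b_1 <= ...]: write [g] as [diag(s^b) M] with [M] integral; if [M] is
    singular modulo [s], a polynomial row operation makes one row divisible by [s], which
    lowers the order of [det M].

    For such a representative the height is [q^h] with [h] the maximum over [j] of
    [H_j / d], where [H_j] is the sum of [b_i' - b_i] over [i < j <= i'], while unipotent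
    matrices show that the stabilizer has at least [q^N] elements, [N] being the sum of
    [b_i' - b_i] over all pairs [i < i'].  As [N >= H_j + \sum_(l <> j) n_l] with
    [n_l] the consecutive differences, taking [H_j] and the [n_l], [l <> j], as coordinates
    bounds the mass of [H_j > d log_q T] by a geometric tail of size [T^-d] times convergent
    geometric series.  The lower bound comes from the single point [b = (0, m, ..., m)] with
    [m] minimal such that its height exceeds [T]. *)

Set Implicit Arguments.
Unset Strict Implicit.
Unset Printing Implicit Defensive.

Import Order.TTheory GRing.Theory Num.Theory.
Local Open Scope classical_set_scope.
Local Open Scope ring_scope.

(** * Power series and the absolute value *)

Section PowerSeriesDivision.
Variable k : fieldType.
Implicit Types a b c : power_series k.

(** The first [n.+1] coefficients of the inverse series. Each new coefficient depends on all earlier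
    ones, so a growing list keeps the recursion structural. *)
Fixpoint ps_inv_seq a n : seq k :=
  if n is m.+1 then
    rcons (ps_inv_seq a m)
      (- (pscoef a 0)^-1 * \sum_(i < m.+1) (ps_inv_seq a m)`_i * pscoef a (m.+1 - i))
  else [:: (pscoef a 0)^-1].

Lemma size_ps_inv_seq a n : size (ps_inv_seq a n) = n.+1.
Proof. by elim: n => //= n IH; rewrite size_rcons IH. Qed.

Lemma nth_ps_inv_seq a n i : (i <= n)%N -> (ps_inv_seq a n)`_i = (ps_inv_seq a i)`_i.
Proof.
elim: n => [|n IH]; first by rewrite leqn0 => /eqP->.
rewrite leq_eqVlt => /orP[/eqP-> //|lt_in].
by rewrite [ps_inv_seq a n.+1]/= nth_rcons size_ps_inv_seq lt_in IH.
Qed.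

Lemma ps_unit_coef0 a : pscoef a 0 != 0 -> a \is a GRing.unit.
Proof.
move=> a0; apply/unitrP.
pose b := PSeries (fun n => (ps_inv_seq a n)`_n).
suff ba : b * a = 1 by exists b; split=> //; rewrite mulrC.
apply: power_seriesP => -[|n].
  by rewrite [LHS]/= big_ord1 /= mulVf.
rewrite [LHS]big_ord_recr [pscoef b n.+1]/= subnn nth_rcons size_ps_inv_seq.
rewrite ltnn eqxx mulrAC mulNr mulVf // mulN1r.
by apply/eqP; rewrite subr_eq0; apply/eqP/eq_bigr => i _; rewrite nth_ps_inv_seq // -ltnS.
Qed.

Definition ps_coef0 a : k := pscoef a 0.

Lemma pscoef0M a b : pscoef (a * b) 0 = pscoef a 0 * pscoef b 0.
Proof. by rewrite [LHS]/= big_ord1. Qed.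

Fact ps_coef0_zmod_morphism : zmod_morphism ps_coef0.
Proof. by []. Qed.
Fact ps_coef0_monoid_morphism : monoid_morphism ps_coef0.
Proof. by split=> // a b; exact: pscoef0M. Qed.
HB.instance Definition _ := GRing.isZmodMorphism.Build (power_series k) k
  ps_coef0 ps_coef0_zmod_morphism.
HB.instance Definition _ := GRing.isMonoidMorphism.Build (power_series k) k
  ps_coef0 ps_coef0_monoid_morphism.

Lemma pscoef_varM a n : pscoef (ps_var k * a) n.+1 = pscoef a n.
Proof.
rewrite [LHS]/= big_ord_recl big_ord_recl [X in _ + (_ + X)]big1 /=.
  by rewrite mul0r mul1r add0r addr0 /bump /= subn1.
by move=> i _; rewrite mul0r.
Qed.

Lemma ps_divS a : pscoef a 0 = 0 -> a = ps_var k * PSeries (fun n => pscoef a n.+1).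
Proof.
move=> a0; apply: power_seriesP => -[|n]; last by rewrite pscoef_varM.
by rewrite pscoef0M a0 mul0r.
Qed.

Lemma ps_var_neq0 : ps_var k != 0.
Proof.
by apply/eqP => /(congr1 (fun a => pscoef a 1)) /= /eqP; rewrite oner_eq0.
Qed.

Lemma ps_ord0 a : pscoef a 0 != 0 -> ps_ord a = 0%N.
Proof. by move=> a0; apply: ps_ord_eq. Qed.

Lemma ps_ord_var : ps_ord (ps_var k) = 1%N.
Proof. by apply: ps_ord_eq => [|[]] //=; rewrite oner_neq0. Qed.

(** A vanishing constant coefficient lets one factor [ps_var] be split off, which lowers the order
    by one; at order zero the series is a unit. *)
Lemma ps_factor a : a != 0 ->
  exists2 u, u \is a GRing.unit & a = ps_var k ^+ ps_ord a * u.
Proof.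
have [n] := ubnP (ps_ord a); elim: n a => // n IH a lt_an a0.
have [c0|c0] := eqVneq (pscoef a 0) 0; last first.
  by exists a; rewrite ?ps_unit_coef0 // ps_ord0 // mul1r.
have aE := ps_divS c0; set a' := PSeries _ in aE.
have a'0 : a' != 0 by apply: contra_neq a0 => a'0; rewrite aE a'0 mulr0.
have oE : ps_ord a = (ps_ord a').+1 by rewrite aE ps_ordM ?ps_var_neq0 ?ps_ord_var.
rewrite oE ltnS in lt_an; have [u uu e] := IH a' lt_an a'0.
by exists u; rewrite // oE exprS -mulrA -e.
Qed.

Lemma ps_dvd a b : b != 0 -> (ps_ord b <= ps_ord a)%N -> exists c, a = b * c.
Proof.
move=> b0 le_ba; have [->|a0] := eqVneq a 0; first by exists 0; rewrite mulr0.
have [u _ ->] := ps_factor a0; have [v vu bE] := ps_factor b0.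
exists (ps_var k ^+ (ps_ord a - ps_ord b) * (v^-1 * u)).
by rewrite {1}bE mulrACA -exprD subnKC // mulVKr.
Qed.

End PowerSeriesDivision.

(** * Absolute value on Laurent series: multiplicativity, ultrametric inequality, values on
    polynomials *)

Section LaurentAbs.
Variables (R : realType) (k : finFieldType).
Local Notation F := (laurent k).
Local Notation O := (power_series k).
Local Notation ps := (@power_series_laurent k).
Local Notation pl := (@poly_laurent k).
Local Notation q := (#|k|%:R : R).
Implicit Types x y : F.

Lemma card_field_gt1 : 1 < q.
Proof. by rewrite ltr1n; exact: card_finNzRing_gt1. Qed.

Lemma card_field_gt0 : 0 < q.
Proof. exact: lt_trans card_field_gt1. Qed.

Lemma laurent_frac x : exists a b : O, b != 0 /\ x = ps a / ps b.
Proof.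
exists (repr x).1, (repr x).2; split; first exact: denom_ratioP.
rewrite -[x in LHS]reprK -[repr x in LHS]Ratio_numden.
rewrite /power_series_laurent; unlock FracField.tofrac.
rewrite -[(_ (Ratio _.2 1))^-1]FracField.pi_inv -[RHS]FracField.pi_mul.
congr (\pi _)%qT; rewrite /FracField.mulf /FracField.invf.
by rewrite !numden_Ratio ?oner_neq0 ?denom_ratioP // mulr1 mul1r.
Qed.

Lemma psl_eq0 (a : O) : (ps a == 0) = (a == 0).
Proof. exact: tofrac_eq0. Qed.

Lemma labs0 : labs R (0 : F) = 0.
Proof. by rewrite /labs eqxx. Qed.

Lemma labs_gt0 x : x != 0 -> 0 < labs R x.
Proof. by move=> x0; rewrite /labs (negPf x0) exprz_gt0 ?card_field_gt0. Qed.

Lemma labs_ge0 x : 0 <= labs R x.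
Proof. by have [->|/labs_gt0/ltW //] := eqVneq x 0; rewrite labs0. Qed.

Lemma labs_eq0 x : (labs R x == 0) = (x == 0).
Proof.
by have [->|x0] := eqVneq x 0; rewrite ?labs0 ?eqxx ?gt_eqF ?labs_gt0 ?(negPf x0).
Qed.

Lemma labsM : {morph labs R (k:=k) : x y / x * y}.
Proof.
move=> x y.
have [->|x0] := eqVneq x 0; first by rewrite mul0r labs0 mul0r.
have [->|y0] := eqVneq y 0; first by rewrite mulr0 labs0 mulr0.
have [a [b [b0 xE]]] := laurent_frac x; have [c [e [e0 yE]]] := laurent_frac y.
have a0 : a != 0 by apply: contra_neq x0 => a0; rewrite xE a0 rmorph0 mul0r.
have c0 : c != 0 by apply: contra_neq y0 => c0; rewrite yE c0 rmorph0 mul0r.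
rewrite xE yE mulf_div -!rmorphM !labs_frac ?mulf_neq0 // -expfzDr ?gt_eqF ?card_field_gt0 //.
by rewrite !ps_ordM //; congr (_ ^ _); lia.
Qed.

Lemma labs_ps (a : O) : a != 0 -> labs R (ps a) = q ^- ps_ord a.
Proof.
move=> a0; rewrite -[ps a]divr1 -(rmorph1 ps) labs_frac ?oner_neq0 //.
by rewrite exprnN (ps_ord0 (a := 1)) ?sub0r //= oner_neq0.
Qed.

Lemma labs_ps_le1 (a : O) : labs R (ps a) <= 1.
Proof.
have [->|a0] := eqVneq a 0; first by rewrite rmorph0 labs0.
by rewrite labs_ps // invf_le1 ?exprn_gt0 ?card_field_gt0 // exprn_ege1 // ltW ?card_field_gt1.
Qed.

Lemma labs1 : labs R (1 : F) = 1.
Proof. by rewrite -(rmorph1 ps) labs_ps ?oner_neq0 // ps_ord0 ?invr1 //= oner_neq0. Qed.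

Lemma labsX x n : labs R (x ^+ n) = labs R x ^+ n.
Proof. by elim: n => [|n IH]; rewrite ?labs1 // !exprS labsM IH. Qed.

Lemma labsV x : labs R x^-1 = (labs R x)^-1.
Proof.
have [->|x0] := eqVneq x 0; first by rewrite invr0 labs0 invr0.
apply: (mulfI (lt0r_neq0 (labs_gt0 x0))).
by rewrite -labsM mulfV // labs1 mulfV // gt_eqF ?labs_gt0.
Qed.

Lemma labs_prod (I : Type) (r : seq I) (P : pred I) (f : I -> F) :
  labs R (\prod_(i <- r | P i) f i) = \prod_(i <- r | P i) labs R (f i).
Proof. exact: (big_morph _ labsM labs1). Qed.

Lemma labs_sign n : labs R ((-1) ^+ n : F) = 1.
Proof.
rewrite labsX; suff -> : labs R (-1 : F) = 1 by rewrite expr1n.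
by apply/eqP; rewrite -(@eqrXn2 _ 2) ?labs_ge0 // -labsX expr2 mulrNN mulr1 labs1 expr1n.
Qed.

Lemma labs_le1_ps x : labs R x <= 1 -> exists a : O, x = ps a.
Proof.
have [->|x0] := eqVneq x 0; first by exists 0; rewrite rmorph0.
have [a [b [b0 xE]]] := laurent_frac x.
have a0 : a != 0 by apply: contra_neq x0 => a0; rewrite xE a0 rmorph0 mul0r.
rewrite xE labs_frac // -(expr0z q) ler_eXz2l ?card_field_gt1 // => le_ba.
have [|c ->] := @ps_dvd _ a b b0; first by lia.
exists c; have pb0 : ps b != 0 by rewrite psl_eq0.
by rewrite rmorphM mulrAC mulfV // mul1r.
Qed.

(** Dividing by the larger summand [y] puts [x / y] in the valuation ring, and [x / y + 1] stays
    there. *)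
Lemma labsD_le x y r : labs R x <= r -> labs R y <= r -> labs R (x + y) <= r.
Proof.
wlog le_xy : x y / labs R x <= labs R y.
  move=> h hx hy; have [/h|/ltW/h] := leP (labs R x) (labs R y); first exact.
  by rewrite addrC; apply.
have [->|y0] := eqVneq y 0; first by rewrite addr0.
move=> _; apply: le_trans.
have [|a xyE] := @labs_le1_ps (x / y).
  by rewrite labsM labsV ler_pdivrMr ?mul1r ?labs_gt0.
have -> : x + y = ps (a + 1) * y by rewrite rmorphD rmorph1 /= -xyE mulrDl divfK // mul1r.
by rewrite labsM ler_piMl ?labs_ge0 ?labs_ps_le1.
Qed.

Lemma labs_sum_le (I : Type) (s : seq I) (P : pred I) (f : I -> F) r : 0 <= r ->
  (forall i, P i -> labs R (f i) <= r) -> labs R (\sum_(i <- s | P i) f i) <= r.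
Proof.
move=> r0 h; apply: (big_ind (fun x => labs R x <= r)) => //; first by rewrite labs0.
by move=> x y; exact: labsD_le.
Qed.

Lemma psl_varK : tvar k * ps (ps_var k) = 1.
Proof. by rewrite mulVf // psl_eq0 ps_var_neq0. Qed.

Lemma poly_laurentE (p : {poly k}) :
  pl p = \sum_(i < size p) ps (ps_const p`_i) * tvar k ^+ i.
Proof.
rewrite /poly_laurent /horner_morph horner_coef size_map_poly.
by apply: eq_bigr => i _; rewrite coef_map.
Qed.

Lemma poly_laurent_ps (p : {poly k}) n : (size p <= n.+1)%N ->
  pl p * ps (ps_var k) ^+ n = ps (\sum_(i < size p) ps_const p`_i * ps_var k ^+ (n - i)).
Proof.
move=> sz; rewrite poly_laurentE mulr_suml rmorph_sum; apply: eq_bigr => i _.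
rewrite rmorphM rmorphXn -mulrA /=; congr (_ * _).
have le_in : (i <= n)%N by rewrite -ltnS (leq_trans (ltn_ord i)).
by rewrite -{1}(subnKC le_in) exprD mulrA -exprMn psl_varK expr1n mul1r.
Qed.

Lemma labs_poly (p : {poly k}) : p != 0 -> labs R (pl p) = q ^+ (size p).-1.
Proof.
move=> p0; have sp : (0 < size p)%N by rewrite size_poly_gt0.
have := @poly_laurent_ps p (size p).-1; rewrite prednK // leqnn => /(_ isT).
set a := \sum_(i < _) _ => pE.
(* Multiplying by [s^(deg p)] reverses the coefficients: the leading one becomes the constant term,
   so [a] has order zero. *)
have a0 : ps_coef0 a = lead_coef p.
  have lt_n : ((size p).-1 < size p)%N by rewrite prednK.
  have cE (c : k) n : ps_coef0 (ps_const c * ps_var k ^+ n) = if n == 0%N then c else 0.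
    case: n => [|n]; first by rewrite mulr1.
    by rewrite /ps_coef0 exprS !pscoef0M /= mul0r mulr0.
  rewrite /a rmorph_sum (bigD1 (Ordinal lt_n)) // big1 => [|i ni].
    by rewrite [LHS]addr0 [LHS]cE subnn.
  have ne : ((size p).-1 - i != 0)%N.
    apply: contraNneq ni => /eqP; rewrite subn_eq0 => le_si.
    by rewrite -val_eqE /= eqn_leq le_si -ltnS prednK // ltn_ord.
  by rewrite [LHS]cE (negPf ne).
have a00 : pscoef a 0 != 0 by rewrite [X in X != 0]a0 lead_coef_eq0.
have an0 : a != 0 by apply: contraNneq a00 => ->.
have := congr1 (labs R (k:=k)) pE.
rewrite labs_ps // ps_ord0 // invr1 labsM labsX labs_ps ?ps_var_neq0 // ps_ord_var expr1.
by rewrite exprVn => /(canRL (mulfVK _)) ->; rewrite ?mul1r // expf_neq0 ?gt_eqF ?card_field_gt0.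
Qed.

(** Discreteness of [k[t]] in the Laurent field; this is what keeps wedge products of lattice
    vectors away from zero. *)
Lemma labs_poly_ge1 (p : {poly k}) : p != 0 -> 1 <= labs R (pl p).
Proof. by move=> p0; rewrite labs_poly // exprn_ege1 // ltW ?card_field_gt1. Qed.

Lemma poly_laurent_eq0 (p : {poly k}) : (pl p == 0) = (p == 0).
Proof.
apply/eqP/eqP => [|->]; last by rewrite rmorph0.
apply: contra_eq => /labs_poly_ge1 h; rewrite -labs_eq0 gt_eqF //.
exact: lt_le_trans h.
Qed.

Lemma poly_laurent_inj : injective pl.
Proof. by move=> p r /eqP; rewrite -subr_eq0 -rmorphB poly_laurent_eq0 subr_eq0 => /eqP. Qed.

Lemma labs_poly_le (p : {poly k}) n : labs R (pl p) <= q ^+ n -> (size p <= n.+1)%N.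
Proof.
have [->|p0] := eqVneq p 0; first by rewrite size_poly0.
rewrite labs_poly // ler_eXn2l ?card_field_gt1 //.
by have := p0; rewrite -size_poly_gt0; lia.
Qed.

Lemma labs_poly_unit (p : {poly k}) : p \is a GRing.unit -> labs R (pl p) = 1.
Proof.
rewrite poly_unitE => /andP[/eqP sp p0].
by rewrite labs_poly -?size_poly_gt0 sp.
Qed.

Lemma labs_ps_unit (a : O) : a \is a GRing.unit -> labs R (ps a) = 1.
Proof.
move=> ua; apply/eqP; rewrite eq_le labs_ps_le1 /=.
have := labs_ps_le1 a^-1; rewrite rmorphV // labsV invf_le1 //.
by rewrite labs_gt0 // psl_eq0; apply: contraTneq ua => ->; rewrite unitr0.
Qed.

End LaurentAbs.

(** * Exterior norms and minors *)

Lemma perm_sorted_nat (n : nat) (f : 'I_n -> nat) :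
  exists s : 'S_n, forall i j : 'I_n, (i <= j)%N -> (f (s i) <= f (s j))%N.
Proof.
pose t := sort_tuple (fun i j : 'I_n => (f i <= f j)%N) (ord_tuple n).
have /tuple_permP[s tE] : perm_eq t (ord_tuple n) by rewrite /= perm_sort.
exists s => i j le_ij.
have nE (l : 'I_n) : s l = tnth t l.
  by rewrite (tnth_nth l) tE -tnth_nth !tnth_mktuple tnth_ord_tuple.
have srt : sorted (fun i j : 'I_n => (f i <= f j)%N) t.
  by apply: sort_sorted => a b; exact: leq_total.
rewrite !nE !(tnth_nth i).
apply: (sorted_leq_nth _ _ _ srt) => //; try by rewrite inE size_tuple.
by move=> a b c; exact: leq_trans.
Qed.

Lemma det_rowsub_perm (A : comNzRingType) (m n : nat) (f : 'I_n -> 'I_m) (s : 'S_n)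
    (V : 'M[A]_(m, n)) :
  \det (rowsub (f \o s) V) = (-1) ^+ s * \det (rowsub f V).
Proof.
rewrite -det_perm -det_mulmx -row_permE; congr (\det _).
by apply/matrixP => i j; rewrite !mxE.
Qed.

(** Cauchy-Binet before grouping terms: multilinearity in the rows gives a sum over all maps [f],
    not only the increasing ones. *)
Lemma det_mulmx_rowsub (A : comNzRingType) (m n : nat) (M : 'M[A]_(n, m)) (V : 'M[A]_(m, n)) :
  \det (M *m V) =
  \sum_(f : {ffun 'I_n -> 'I_m}) (\prod_i M i (f i)) * \det (rowsub f V).
Proof.
rewrite /determinant; under [RHS]eq_bigr do rewrite big_distrr /=.
rewrite exchange_big /=; apply: eq_bigr => s _.
under eq_bigr do rewrite mxE.
rewrite bigA_distr_bigA /= big_distrr /=; apply: eq_bigr => f _.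
rewrite big_split /= mulrCA; congr (_ * (_ * _)).
by apply: eq_bigr => i _; rewrite mxE.
Qed.

Section Wedge.
Variables (R : realType) (k : finFieldType) (d j : nat).
Local Notation F := (laurent k).
Local Notation O := (power_series k).
Local Notation ps := (@power_series_laurent k).
Implicit Types V : 'M[F]_(d, j).

Lemma wedge_norm_ge0 V : 0 <= wedge_norm R V.
Proof. by apply: bigmax_ge_id. Qed.

(** [wedge_norm] only ranges over increasing row choices; a repeated row gives minor zero, and
    sorting distinct rows changes only the sign. *)
Lemma labs_minor_le (f : 'I_j -> 'I_d) V : labs R (\det (rowsub f V)) <= wedge_norm R V.
Proof.
have [/injectiveP f_inj|/injectivePn[a [b ab fab]]] := boolP (injectiveb f); last first.
  rewrite (determinant_alternate ab) ?labs0 ?wedge_norm_ge0 // => i.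
  by rewrite !mxE fab.
have [s sP] := perm_sorted_nat (fun i => f i : nat).
have -> : labs R (\det (rowsub f V)) = labs R (\det (rowsub (finfun (f \o s)) V)).
  have -> : rowsub (finfun (f \o s)) V = rowsub (f \o s) V.
    by apply/matrixP => a b; rewrite !mxE ffunE.
  by rewrite det_rowsub_perm labsM labs_sign mul1r.
apply: (le_bigmax_cond _ (fun f : {ffun 'I_j -> 'I_d} => labs R (\det (rowsub f V)))).
apply/forallP => a; apply/forallP => b; apply/implyP => lt_ab; rewrite !ffunE /=.
rewrite ltn_neqAle sP ?(ltnW lt_ab) // andbT.
by apply/negP => /eqP /val_inj /f_inj /perm_inj e; rewrite e ltnn in lt_ab.
Qed.

Lemma wedge_norm_attained V : 0 < wedge_norm R V ->
  exists f : {ffun 'I_j -> 'I_d}, [/\ forall a b : 'I_j, (a < b)%N -> (f a < f b)%N &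
    labs R (\det (rowsub f V)) = wedge_norm R V].
Proof.
rewrite {1}/wedge_norm => /bigmax_gtP[|[f0 f0P _]]; first by rewrite ltxx.
pose P (f : {ffun 'I_j -> 'I_d}) :=
  [forall a : 'I_j, forall b : 'I_j, (a < b)%N ==> (f a < f b)%N].
have := @bigmax_eq_arg _ _ _ 0 f0 P (fun f => labs R (\det (rowsub f V))) f0P.
move=> /(_ (fun f _ => labs_ge0 R _)).
case: arg_maxP => // f fP _ e; exists f; split; last by rewrite /wedge_norm -e.
by move=> a b lt_ab; move/forallP/(_ a)/forallP/(_ b)/implyP/(_ lt_ab) : fP.
Qed.

(** Each minor of the product is a combination of minors of [V] with integral coefficients, so the
    ultrametric inequality applies. Applied to [B] and to its inverse, it shows that [K] acts by
    isometries. *)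
Lemma wedge_norm_map_le (B : 'M[O]_d) V : wedge_norm R (map_mx ps B *m V) <= wedge_norm R V.
Proof.
apply: bigmax_le => [|f _]; first exact: wedge_norm_ge0.
have -> : rowsub f (map_mx ps B *m V) = rowsub f (map_mx ps B) *m V.
  by apply/matrixP => a b; rewrite !mxE; apply: eq_bigr => c _; rewrite !mxE.
rewrite det_mulmx_rowsub; apply: labs_sum_le => [|g _]; first exact: wedge_norm_ge0.
rewrite labsM; apply: le_trans (labs_minor_le g V).
rewrite ler_piMl ?labs_ge0 // labs_prod; apply: Num.Theory.prodr_ile1 => i _.
by rewrite labs_ge0 !mxE labs_ps_le1.
Qed.

Lemma wedge_norm_gt0 V : row_free V^T -> 0 < wedge_norm R V.
Proof.
move=> Vfree; have Vfull : row_full V by rewrite /row_full -mxrank_tr.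
have h := labs_minor_le (fullrankfun Vfull) V; apply: lt_le_trans h.
by rewrite labs_gt0 // -unitfE -unitmxE fullrowsub_unit.
Qed.

End Wedge.

(** * Diagonal representatives *)

Definition subst_row1 (A : comNzRingType) (n : nat) (i : 'I_n) (r : 'I_n -> A) : 'M[A]_n :=
  \matrix_(a, b) if a == i then r b else (a == b)%:R.

Lemma det_subst_row1 (A : comNzRingType) (n : nat) (i : 'I_n) (r : 'I_n -> A) :
  \det (subst_row1 i r) = r i.
Proof.
rewrite (expand_det_row _ i); under eq_bigr => j _.
  (* Cofactors along row [i] do not see row [i], so they are those of the identity matrix. *)
  rewrite mxE eqxx; have -> : cofactor (subst_row1 i r) i j = \adj (1%:M : 'M[A]_n) j i.
    rewrite mxE /cofactor; congr (_ * \det _); apply/matrixP => a b.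
    by rewrite !mxE eq_sym (negPf (neq_lift _ _)).
  rewrite adj1 mxE; over.
rewrite (bigD1 i) //= eqxx mulr1 big1 ?addr0 // => j /negPf ji.
by rewrite ji mulr0.
Qed.

Section Birkhoff.
Variable k : finFieldType.
Local Notation F := (laurent k).
Local Notation O := (power_series k).
Local Notation ps := (@power_series_laurent k).
Local Notation pl := (@poly_laurent k).
Local Notation s := (ps (ps_var k)).

Definition diag_pow (d : nat) (b : 'I_d -> nat) : 'M[F]_d := diag_mx (\row_i s ^+ b i).

Lemma s_neq0 : s != 0.
Proof. by rewrite psl_eq0 ps_var_neq0. Qed.

Lemma tvarX_sX m n : (m <= n)%N -> tvar k ^+ m * s ^+ n = s ^+ (n - m).
Proof. by move=> le_mn; rewrite -{1}(subnKC le_mn) exprD mulrA -exprMn psl_varK expr1n mul1r. Qed.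

Lemma pl_const (c : k) : pl c%:P = ps (ps_const c).
Proof. by rewrite /poly_laurent /horner_morph map_polyC hornerC. Qed.

Lemma plX : pl 'X = tvar k.
Proof. by rewrite /poly_laurent /horner_morph map_polyX hornerX. Qed.

Lemma row_reduction (d : nat) (M : 'M[O]_d) (b : 'I_d -> nat) : \det M != 0 ->
  exists (C : 'M[{poly k}]_d) (b' : 'I_d -> nat) (B : 'M[O]_d),
    [/\ C \in unitmx, B \in unitmx &
      map_mx pl C *m (diag_pow b *m map_mx ps M) = diag_pow b' *m map_mx ps B].
Proof.
have [n] := ubnP (ps_ord (\det M)); elim: n M b => // n IH M b lt_n M0.
have [c0|c0] := eqVneq (ps_coef0 (\det M)) 0; last first.
  exists 1%:M, b, M; rewrite unitmx1 map_mx1 mul1mx; split=> //.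
  by rewrite unitmxE ps_unit_coef0.
(* A vanishing determinant modulo [s] yields a nonzero constant relation [c] between the rows of [M]
   modulo [s]. *)
have /eqP/det0P[c cn0 cM] : \det (map_mx (@ps_coef0 k) M) = 0 by rewrite det_map_mx.
have /rV0Pn[i0 ci0] := cn0.
pose P := [pred i : 'I_d | c 0 i != 0].
(* Among the rows in the support of [c], row [i] has the least exponent, so [b j - b i] is a genuine
   difference whenever [c 0 j] is nonzero and [C0] is polynomial. *)
case: (@arg_minnP _ i0 P b ci0) => i ci imin.
pose C0 : 'M[{poly k}]_d := subst_row1 i (fun j => (c 0 j)%:P * 'X^(b j - b i)).
pose N := subst_row1 i (fun j => ps_const (c 0 j)) *m M.
have Ni j : ps_coef0 (N i j) = 0.
  have := congr1 (fun A : 'rV[k]_d => A 0 j) cM; rewrite !mxE => e.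
  rewrite rmorph_sum -[RHS]e; apply: eq_bigr => l _.
  by rewrite rmorphM !mxE eqxx.
(* Row [i] of [N] vanishes modulo [s]; [M'] is [N] with that row divided by [s]. *)
pose M' : 'M[O]_d :=
  \matrix_(a, j) if a == i then PSeries (fun l => pscoef (N a j) l.+1) else M a j.
have NE : N = diag_mx (\row_a if a == i then ps_var k else 1) *m M'.
  apply/matrixP => a j; rewrite mul_diag_mx !mxE.
  have [->|ai] := eqVneq a i; first by rewrite -ps_divS //; have := Ni j; rewrite mxE.
  rewrite mul1r (bigD1 a) //= mxE (negPf ai) eqxx mul1r big1 ?addr0 // => l /negPf la.
  by rewrite mxE (negPf ai) eq_sym la mul0r.
have dN : \det N = ps_const (c 0 i) * \det M by rewrite det_mulmx det_subst_row1.
have dN' : \det N = ps_var k * \det M'.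
  rewrite NE det_mulmx det_diag (bigD1 i) //= mxE eqxx big1 ?mulr1 // => j /negPf ji.
  by rewrite mxE ji.
have cc0 : ps_const (c 0 i) != 0.
  by apply: contraNneq ci => /(congr1 (@ps_coef0 k)) /= ->.
have M'0 : \det M' != 0.
  have : \det N != 0 by rewrite dN mulf_neq0.
  by rewrite dN'; apply: contraNneq => ->; rewrite mulr0.
have oM : ps_ord (\det M) = (ps_ord (\det M')).+1.
  have := congr1 (@ps_ord k) dN; rewrite {1}dN' !ps_ordM ?ps_var_neq0 // ps_ord_var.
  by rewrite (ps_ord0 (a := ps_const _)).
rewrite oM ltnS in lt_n.
(* The factor [s] removed from row [i] moves into the diagonal exponent. *)
pose b1 a := (b a + (a == i))%N.
have [C1 [b' [B [C1u Bu e]]]] := IH M' b1 lt_n M'0.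
exists (C1 *m C0), b', B; split=> //.
  rewrite unitmx_mul C1u unitmxE det_subst_row1 subnn expr0 mulr1.
  by rewrite rmorph_unit // unitfE.
rewrite -e map_mxM -mulmxA; congr (_ *m _).
have -> : diag_pow b1 *m map_mx ps M' = diag_pow b *m map_mx ps N.
  rewrite NE map_mxM mulmxA; congr (_ *m _); apply/matrixP => a j.
  rewrite mul_diag_mx !mxE.
  have [_|_] := eqVneq a j; last by rewrite !mulr0n rmorph0 mulr0.
  rewrite !mulr1n /b1.
  by case: eqP => _; rewrite ?addn0 ?rmorph1 ?mulr1 // exprD expr1.
(* Moving past the diagonal turns the polynomial row operation into the constant one, since
   [t^(b j - b i) s^(b j) = s^(b i)]. *)
rewrite map_mxM !mulmxA; congr (_ *m _); apply/matrixP => a j.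
rewrite mul_mx_diag mul_diag_mx !mxE.
have [->|ai] := eqVneq a i; last first.
  by rewrite !rmorph_nat; have [->|_] := eqVneq a j; rewrite ?mul1r ?mulr1 // mul0r mulr0.
rewrite rmorphM rmorphXn /= pl_const plX.
have [->|cj] := eqVneq (c 0 j) 0; first by rewrite !rmorph0 !mul0r mulr0.
by rewrite -mulrA tvarX_sX ?leq_subr // subKn ?imin // mulrC.
Qed.

End Birkhoff.

Lemma unitmx_det_neq0 (K : fieldType) (n : nat) (A : 'M[K]_n) :
  (A \in unitmx) = (\det A != 0).
Proof. by rewrite unitmxE unitfE. Qed.

Lemma det_scale_neq0 (K : fieldType) (n : nat) (c : K) (A : 'M[K]_n) :
  c != 0 -> A \in unitmx -> \det (c *: A) != 0.
Proof.
move=> c0; rewrite unitmx_det_neq0 detZ => A0.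
by apply: mulf_neq0 => //; exact: expf_neq0.
Qed.

(** * Sorted and normalized diagonal representatives *)

Section Decomposition.
Variable k : finFieldType.
Local Notation F := (laurent k).
Local Notation O := (power_series k).
Local Notation ps := (@power_series_laurent k).
Local Notation pl := (@poly_laurent k).
Local Notation s := (ps (ps_var k)).

Lemma clear_denominators (d : nat) (A : 'M[F]_d) :
  exists (e : O) (M : 'M[O]_d), e != 0 /\ ps e *: A = map_mx ps M.
Proof.
have /fin_all_exists[a aP] (p : 'I_d * 'I_d) :
    exists a : O * O, a.2 != 0 /\ A p.1 p.2 = ps a.1 / ps a.2.
  by have [a [b ?]] := laurent_frac (A p.1 p.2); exists (a, b).
exists (\prod_p (a p).2).
exists (\matrix_(i, j) ((a (i, j)).1 * \prod_(p | p != (i, j)) (a p).2)).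
split; first by apply/prodf_neq0 => p _; have [] := aP p.
apply/matrixP => i j; rewrite !mxE (bigD1 (i, j)) //= !rmorphM.
have [/= b0 ->] := aP (i, j).
have pb0 : ps (a (i, j)).2 != 0 by rewrite psl_eq0.
by rewrite mulrC -mulrA mulKf.
Qed.

Lemma diag_pow_sort (d : nat) (b : 'I_d -> nat) (t : 'S_d) :
  diag_pow k b = perm_mx t^-1%g *m diag_pow k (b \o t) *m perm_mx t.
Proof.
rewrite -[t in X in _ *m X]invgK -col_permE -row_permE.
apply/matrixP => i j; rewrite !mxE /= permKV.
by rewrite (inj_eq perm_inj).
Qed.

Lemma diag_pow_unit (d : nat) (b : 'I_d -> nat) : diag_pow k b \in unitmx.
Proof.
rewrite unitmx_det_neq0 det_diag; apply/prodf_neq0 => i _.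
by rewrite mxE expf_neq0 ?s_neq0.
Qed.

Lemma GL_decomposition (d : nat) (A : 'M[F]_d.+1) : A \in unitmx ->
  exists (c : F) (C : 'M[{poly k}]_d.+1) (b : 'I_d.+1 -> nat) (B : 'M[O]_d.+1),
    [/\ [/\ c != 0, C \in unitmx & B \in unitmx],
        {homo b : i j / (i <= j)%N}, b ord0 = 0%N &
        A = c *: (map_mx pl C *m diag_pow k b *m map_mx ps B)].
Proof.
move=> Au; have [e [M [e0 eA]]] := clear_denominators A.
have pe0 : ps e != 0 by rewrite psl_eq0.
have M0 : \det M != 0.
  have : \det (ps e *: A) != 0.
    by have := det_scale_neq0 pe0 Au.
  by rewrite eA det_map_mx psl_eq0.
have [C [b [B [Cu Bu]]]] := row_reduction (fun=> 0%N) M0.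
have -> : diag_pow k (fun=> 0%N) = (1%:M : 'M[F]_d.+1).
  by apply/matrixP => i j; rewrite !mxE expr0.
rewrite mul1mx => CM.
have [t tP] := perm_sorted_nat b.
(* Subtracting the least exponent makes the first one zero; the corresponding power of [s] goes into
   the homothety factor. *)
pose b0 i := (b (t i) - b (t ord0))%N.
exists (s ^+ b (t ord0) / ps e), (invmx C *m perm_mx t^-1%g), b0, (perm_mx t *m B); split.
- split; first by rewrite mulf_neq0 ?invr_neq0 ?expf_neq0 ?s_neq0.
    by rewrite unitmx_mul unitmx_inv Cu unitmx_perm.
  by rewrite unitmx_mul unitmx_perm.
- by move=> i j le_ij; apply: leq_sub2r; exact: tP.
- by rewrite /b0 subnn.
apply: (scalerI pe0); rewrite eA scalerA mulrCA mulfV // mulr1.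
have -> : map_mx ps M = map_mx pl (invmx C) *m diag_pow k b *m map_mx ps B.
  by rewrite -mulmxA -CM mulmxA -map_mxM mulVmx // map_mx1 mul1mx.
rewrite (diag_pow_sort b t).
have -> : diag_pow k (b \o t) = s ^+ b (t ord0) *: diag_pow k b0.
  apply/matrixP => i j; rewrite !mxE mulrnAr -exprD /b0 subnKC // tP //.
by rewrite !map_mxM !map_perm_mx -!(scalemxAr, scalemxAl) !mulmxA.
Qed.

End Decomposition.

(** * Stabilizers *)

Lemma leq_card_fset_set_inj (X : finType) (T : choiceType) (S : set T) (f : X -> T) :
  injective f -> (forall x, S (f x)) -> finite_set S -> (#|X| <= #|` fset_set S|)%N.
Proof.
move=> f_inj fS finS; rewrite cardE -(size_map f) uniq_leq_size //.
  by rewrite map_inj_uniq ?enum_uniq.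
by move=> _ /mapP[x _ ->]; rewrite in_fset_set // inE.
Qed.

Lemma card_fset_set_le_inj (X : finType) (T : choiceType) (S : set T) (c : T -> X) :
  (forall x y, S x -> S y -> c x = c y -> x = y) ->
  finite_set S /\ (#|` fset_set S| <= #|X|)%N.
Proof.
move=> c_inj.
have cS : {in S &, injective c} by move=> x y; rewrite !inE; exact: c_inj.
have finS : finite_set S.
  by have := inj_card_eq cS; move/card_eqPle => [_ /card_le_finite]; apply; exact: finite_finset.
split=> //; rewrite -(size_map c) cardE uniq_leq_size //.
  by rewrite map_inj_in_uniq // => x y; rewrite !in_fset_set //; exact: cS.
by move=> z _; rewrite mem_enum.
Qed.

Section DoubleCosets.
Variable k : finFieldType.
Local Notation F := (laurent k).
Local Notation O := (power_series k).
Local Notation ps := (@power_series_laurent k).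
Local Notation pl := (@poly_laurent k).
Local Notation s := (ps (ps_var k)).
Variable d : nat.
Local Notation G := (PGL F d).
Local Notation piG := (\pi_(PGL F d))%qT.

Definition gdiag (b : 'I_d -> nat) : GL F d := MkGL (diag_pow_unit k b).

Lemma unitmx_map_mx (S : comUnitRingType) (f : {rmorphism S -> F}) (B : 'M[S]_d) :
  B \in unitmx -> map_mx f B \in unitmx.
Proof. by rewrite !unitmxE det_map_mx => /(rmorph_unit f). Qed.

Definition GL_map (S : comUnitRingType) (f : {rmorphism S -> F}) (B : 'M[S]_d)
  (Bu : B \in unitmx) : GL F d := MkGL (unitmx_map_mx f Bu).

Lemma piG_eq (A B : GL F d) :
  (piG A = piG B) <-> (exists2 c : F, c != 0 & GLmx A = c *: GLmx B).
Proof.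
split; first by move/eqmodP => /asboolP.
by move=> h; apply/eqmodP/asboolP.
Qed.

Lemma dcoset_gdiagP (b : 'I_d -> nat) (A : GL F d) :
  dcoset_rel (piG (gdiag b)) (piG A) <->
  exists (c : F) (C : 'M[{poly k}]_d) (B : 'M[O]_d),
    [/\ c != 0, C \in unitmx, B \in unitmx &
        GLmx A = c *: (map_mx pl C *m diag_pow k b *m map_mx ps B)].
Proof.
split.
  move=> /asboolP[_ [_ [[A1 [C [-> Cu e1]]] [A2 [B [-> Bu e2]]]]]].
  rewrite -!piM => /piG_eq[c c0 /= e]; exists c, C, B; split=> //.
  by rewrite e e1 e2.
move=> [c [C [B [c0 Cu Bu e]]]]; apply/asboolP.
exists (piG (GL_map pl Cu)), (piG (GL_map ps Bu)); split.
- by exists (GL_map pl Cu), C.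
- by exists (GL_map ps Bu), B.
by rewrite -!piM; apply/piG_eq; exists c.
Qed.

(** For [y = a x b], the factor [b] from [K] drops out of [y K y^-1], while [a] from [Gamma]
    conjugates one stabilizer into the other. *)
Lemma stab_dcoset (x y : G) : dcoset_rel x y ->
  exists a : G, stab y = [set (a * z * a^-1)%g | z in stab x].
Proof.
move=> /asboolP[a [b [Ga Kb ->]]]; exists a; apply/seteqP; split=> z /=.
  move=> [Gz [w Kw zE]]; exists (a^-1 * z * a)%g; last by rewrite !mulgA mulgV mul1g mulgK.
  split; first by apply: PGL_imageM => //; apply: PGL_imageM => //; exact: PGL_imageV.
  exists (b * w * b^-1)%g; first by apply: PGL_imageM; [exact: PGL_imageM|exact: PGL_imageV].
  by rewrite -zE !invMg !mulgA mulVg mul1g mulgKV.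
move=> [w [Gw [u Ku wE]] <-]; split.
  by apply: PGL_imageM; [exact: PGL_imageM|exact: PGL_imageV].
exists (b^-1 * u * b)%g.
  by apply: PGL_imageM => //; apply: PGL_imageM => //; exact: PGL_imageV.
by rewrite -wE !invMg !mulgA mulgK mulgK.
Qed.

Lemma conj_inj (a : G) : injective (fun z => a * z * a^-1)%g.
Proof. by move=> x y /mulIg /mulgI. Qed.

End DoubleCosets.

Lemma det_upper_unitriangular (A : comNzRingType) (n : nat) (M : 'M[A]_n) :
  (forall i j : 'I_n, (j <= i)%N -> M i j = (i == j)%:R) -> \det M = 1.
Proof.
move=> h; rewrite -det_tr det_trig; last first.
  apply/is_trig_mxP => i j lt_ij; rewrite mxE h ?(ltnW lt_ij) //.
  by rewrite -val_eqE /= gtn_eqF.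
by apply: big1 => i _; rewrite mxE h ?eqxx.
Qed.

(** * Lower bound for stabilizers by unipotent matrices *)

Section StabLower.
Variables (R : realType) (k : finFieldType).
Local Notation F := (laurent k).
Local Notation O := (power_series k).
Local Notation ps := (@power_series_laurent k).
Local Notation pl := (@poly_laurent k).
Local Notation s := (ps (ps_var k)).
Variables (d : nat) (b : 'I_d -> nat).
Hypothesis b_homo : {homo b : i j / (i <= j)%N}.
Local Notation piG := (\pi_(PGL F d))%qT.

(** One index for each coefficient of degree below [b j - b i] in entry [(i, j)]. For monotone [b]
    there are none on or below the diagonal, so the matrices are unitriangular. *)
Definition unip_index := {p : 'I_d * 'I_d & 'I_(b p.2 - b p.1)}.
Definition unip_param := {ffun unip_index -> k}.
Implicit Types x y : unip_param.

Definition unip_coef x i j (l : 'I_(b j - b i)) : k :=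
  x (Tagged (fun p : 'I_d * 'I_d => 'I_(b p.2 - b p.1)) (l : 'I_(b (i, j).2 - b (i, j).1))).

Definition unip_poly x : 'M[{poly k}]_d :=
  \matrix_(i, j) ((i == j)%:R + \sum_(l < b j - b i) (unip_coef x l)%:P * 'X^l).

Definition unip_ps x : 'M[O]_d :=
  \matrix_(i, j) ((i == j)%:R +
    \sum_(l < b j - b i) ps_const (unip_coef x l) * ps_var k ^+ (b j - b i - l)).

Lemma sum_ord_eq0 (V : nmodType) (n : nat) (f : 'I_n -> V) : n = 0%N -> \sum_(i < n) f i = 0.
Proof. by move=> n0; apply: big1 => i; have := ltn_ord i; rewrite {2}n0. Qed.

Lemma unip_poly_unit x : unip_poly x \in unitmx.
Proof.
rewrite unitmxE det_upper_unitriangular ?unitr1 // => i j le_ji.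
rewrite mxE sum_ord_eq0 ?addr0 //; apply/eqP; rewrite subn_eq0; exact: b_homo.
Qed.

Lemma unip_ps_unit x : unip_ps x \in unitmx.
Proof.
rewrite unitmxE det_upper_unitriangular ?unitr1 // => i j le_ji.
rewrite mxE sum_ord_eq0 ?addr0 //; apply/eqP; rewrite subn_eq0; exact: b_homo.
Qed.

Lemma unip_conj x :
  map_mx pl (unip_poly x) *m diag_pow k b = diag_pow k b *m map_mx ps (unip_ps x).
Proof.
apply/matrixP => i j; rewrite mul_mx_diag mul_diag_mx !mxE.
rewrite !rmorphD !rmorph_nat mulrDl mulrDr; congr (_ + _).
  by have [->|_] := eqVneq i j; rewrite ?mul1r ?mulr1 // mul0r mulr0.
rewrite !rmorph_sum mulr_suml mulr_sumr; apply: eq_bigr => l _.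
rewrite !rmorphM !rmorphXn /= pl_const plX.
have lt_l := ltn_ord l.
rewrite -mulrA tvarX_sX; last by lia.
by rewrite mulrCA -exprD; congr (_ * s ^+ _); lia.
Qed.

Lemma unip_poly_inj : injective unip_poly.
Proof.
move=> x y /matrixP e; apply/ffunP => -[[i j] l].
have := e i j; rewrite !mxE => /addrI /(congr1 (fun p : {poly k} => p`_l)).
have coefE z : (\sum_(l < b j - b i) (unip_coef z l)%:P * 'X^l)`_l = unip_coef z l.
  rewrite coef_sum (bigD1 l) //= coefCM coefXn eqxx mulr1 big1 ?addr0 // => m ml.
  by rewrite coefCM coefXn eq_sym val_eqE (negPf ml) mulr0.
by rewrite !coefE.
Qed.

Lemma map_pl_inj : injective (map_mx pl : 'M[{poly k}]_d -> 'M[F]_d).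
Proof.
move=> A B /matrixP e; apply/matrixP => i j; apply: (@poly_laurent_inj R k).
by have := e i j; rewrite !mxE.
Qed.

(** By [unip_conj], conjugating a matrix [unip_poly x] by the diagonal gives an integral matrix.
    Finiteness is assumed because [fset_set] of an infinite set is empty. *)
Lemma stab_gdiag_ge : finite_set (stab (piG (gdiag k b))) ->
  (#|k| ^ (\sum_j \sum_i (b j - b i)) <= #|` fset_set (stab (piG (gdiag k b)))|)%N.
Proof.
have -> : (#|k| ^ (\sum_j \sum_i (b j - b i)) = #|{: unip_param}|)%N.
  rewrite card_ffun card_tagged sumnE big_map big_enum /= exchange_big pair_bigA /=.
  by congr (_ ^ _)%N; apply: eq_bigr => p _; rewrite card_ord.
apply: leq_card_fset_set_inj (fun x => piG (GL_map pl (unip_poly_unit x))) _ _.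
  move=> x y /piG_eq[c c0 /= /matrixP e]; apply: unip_poly_inj; apply: map_pl_inj.
  (* Equality in the projective group allows a scalar; comparing diagonal entries, all equal to 1,
     forces it to be 1. *)
  suff c1 (i : 'I_d) : c = 1.
    by apply/matrixP => i j; rewrite e mxE (c1 i) mul1r.
  have := e i i; rewrite !mxE eqxx !sum_ord_eq0 ?subnn //.
  by rewrite addr0 rmorph1 mulr1.
move=> x; split.
  by exists (GL_map pl (unip_poly_unit x)), (unip_poly x); rewrite unip_poly_unit.
exists (piG (GL_map ps (unip_ps_unit x))).
  by exists (GL_map ps (unip_ps_unit x)), (unip_ps x); rewrite unip_ps_unit.
apply: (canLR (mulgK _)); rewrite -!piM; congr (piG _); apply: val_inj => /=.
by rewrite unip_conj.
Qed.

End StabLower.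

(** * Upper bound for the stabilizer at the exponents [(0, m, ..., m)] *)

Section StabUpper.
Variables (R : realType) (k : finFieldType).
Local Notation F := (laurent k).
Local Notation O := (power_series k).
Local Notation ps := (@power_series_laurent k).
Local Notation pl := (@poly_laurent k).
Local Notation s := (ps (ps_var k)).
Local Notation q := (#|k|%:R : R).
Variables (D : nat) (m : nat).
Local Notation piG := (\pi_(PGL F D.+1))%qT.

Definition cusp_exp (i : 'I_D.+1) : nat := if i == ord0 then 0%N else m.

(** The degree bound [m] concerns only the first row off the diagonal; all other entries are
    constants. *)
Definition cusp_stab_rep (x : PGL F D.+1) (C : 'M[{poly k}]_D.+1) : Prop :=
  C \in unitmx /\ (exists2 A : GL F D.+1, x = piG A & GLmx A = map_mx pl C) /\
  forall i j, (size (C i j) <= (if (i == ord0) && (j != ord0) then m else 0).+1)%N.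

Lemma labs_det_pl (n : nat) (C : 'M[{poly k}]_n) : C \in unitmx -> labs R (\det (map_mx pl C)) = 1.
Proof. by rewrite unitmxE det_map_mx => /labs_poly_unit. Qed.

Lemma labs_det_ps (n : nat) (B : 'M[O]_n) : B \in unitmx -> labs R (\det (map_mx ps B)) = 1.
Proof. by rewrite unitmxE det_map_mx => /labs_ps_unit. Qed.

Lemma stab_cusp_rep (x : PGL F D.+1) : stab (piG (gdiag k cusp_exp)) x ->
  exists C, cusp_stab_rep x C.
Proof.
move=> [[A [C [-> Cu AC]]] [_ [B [B' [-> Bu BB]]]]].
move/(canRL (mulgKV _)); rewrite -!piM => /piG_eq[c c0 /= e].
exists C; split=> //; split; first by exists A.
(* Both outer matrices have determinant of absolute value 1, so determinants fix [labs R c].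
   Entrywise, [C i j] is then at most [q^(b j - b i)] in absolute value. *)
have c1 : labs R c = 1.
  have := congr1 (fun M : 'M[F]_D.+1 => labs R (\det M)) e.
  rewrite detZ !det_mulmx !labsM AC BB labs_det_pl // labs_det_ps // mulr1 mul1r.
  have dn0 : labs R (\det (diag_pow k cusp_exp)) != 0.
    by rewrite labs_eq0 -unitmx_det_neq0 diag_pow_unit.
  rewrite -[LHS]mul1r => /(mulIf dn0)/esym; rewrite labsX => h.
  by apply/eqP; rewrite -(@eqrXn2 _ D.+1) ?labs_ge0 // h expr1n.
move=> i j; apply: (@labs_poly_le R).
have := congr1 (fun M : 'M[F]_D.+1 => labs R (M i j)) e.
rewrite AC BB mul_diag_mx mxE [in RHS]mxE mul_mx_diag !mxE !labsM c1 mul1r.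
rewrite !labsX labs_ps ?ps_var_neq0 // ps_ord_var expr1.
move=> h; have {}h : labs R (pl (C i j)) * q^-1 ^+ cusp_exp j <= q^-1 ^+ cusp_exp i.
  rewrite -h ler_piMr ?labs_ps_le1 // exprn_ge0 // invr_ge0 ler0n //.
move: h; rewrite !exprVn ler_pdivrMr ?exprn_gt0 ?card_field_gt0 //.
move=> /le_trans; apply.
rewrite /cusp_exp.
case: (i == ord0); case: (j == ord0) => /=; rewrite ?expr0 ?mulr1 ?invr1 ?mul1r //.
  by rewrite invf_le1 ?exprn_gt0 ?card_field_gt0 // exprn_ege1 // ltW ?card_field_gt1.
by rewrite mulVf // expf_neq0 // gt_eqF ?card_field_gt0.
Qed.

(** All constant terms, together with the [m] higher coefficients of the [D] off-diagonal entries in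
    the first row: enough to recover a matrix obeying the degree bounds. *)
Definition cusp_code (C : 'M[{poly k}]_D.+1) : 'M[k]_D.+1 * 'M[k]_(m, D) :=
  (\matrix_(i, j) (C i j)`_0, \matrix_(l, j) (C ord0 (lift ord0 j))`_l.+1).

Lemma cusp_code_inj x y C C' : cusp_stab_rep x C -> cusp_stab_rep y C' ->
  cusp_code C = cusp_code C' -> x = y.
Proof.
move=> [_ [[A -> AC] szC]] [_ [[A' -> AC'] szC']] [/matrixP e0 /matrixP e1].
congr (piG _); apply: val_inj; rewrite /= AC AC'; congr (map_mx pl _).
apply/matrixP => i j; apply/polyP => -[|l].
  by have := e0 i j; rewrite !mxE.
have [le_sz|lt_l] := leqP (if (i == ord0) && (j != ord0) then m else 0%N) l.
  by rewrite !nth_default ?(leq_trans (szC i j)) ?(leq_trans (szC' i j)).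
have lt_lm : (l < m)%N by move: lt_l; case: ifP.
have := e1 (Ordinal lt_lm); move: lt_l; case: eqP => //= ->.
have [j' ->|->] := unliftP ord0 j; last by rewrite eqxx.
by move=> _ /(_ j'); rewrite !mxE.
Qed.

Lemma stab_cusp_le : finite_set (stab (piG (gdiag k cusp_exp))) /\
  (#|` fset_set (stab (piG (gdiag k cusp_exp)))| <= #|k| ^ (D.+1 ^ 2 + m * D))%N.
Proof.
set S := stab _.
have /choice[c cP] (x : PGL F D.+1) : exists C, S x -> cusp_stab_rep x C.
  have [/stab_cusp_rep[C CP]|nS] := pselect (S x); first by exists C.
  by exists 0.
have -> : (#|k| ^ (D.+1 ^ 2 + m * D) = #|{: 'M[k]_D.+1 * 'M[k]_(m, D)}|)%N.
  by rewrite card_prod !card_mx expnD mulnn.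
apply: (card_fset_set_le_inj (c := cusp_code \o c)) => x y Sx Sy.
exact: cusp_code_inj (cP x Sx) (cP y Sy).
Qed.

End StabUpper.

(** * Heights of diagonal representatives *)

(** Raising to the power [n.+1] removes the fractional exponent in the height. *)
Lemma lt_powR_div (R : realType) (x y : R) (j n : nat) : 0 <= x -> 0 <= y ->
  (y < x `^ (j%:R / n.+1%:R)) = (y ^+ n.+1 < x ^+ j).
Proof.
move=> x0 y0; rewrite -(@ltr_pXn2r _ n.+1) ?nnegrE ?powR_ge0 //.
by rewrite -(powR_mulrn n.+1 (powR_ge0 x _)) -powRrM divfK ?pnatr_eq0 // powR_mulrn.
Qed.

Lemma increasing_ord_ge (j d : nat) (f : 'I_j -> 'I_d) :
  (forall a b : 'I_j, (a < b)%N -> (f a < f b)%N) -> forall i : 'I_j, (i <= f i)%N.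
Proof.
move=> f_incr [i lt_ij] /=; elim: i lt_ij => // i IH lt_ij.
exact: leq_ltn_trans (IH (ltnW lt_ij)) (f_incr (Ordinal (ltnW lt_ij)) (Ordinal lt_ij) (leqnn _)).
Qed.

Lemma row_free_tr_mulmx (K : fieldType) (n j : nat) (M : 'M[K]_n) (V : 'M[K]_(n, j)) :
  M \in unitmx -> row_free V^T -> row_free (M *m V)^T.
Proof.
move=> Mu; rewrite /row_free !mxrank_tr => Vj.
by rewrite (eqmxMfull V) ?Vj ?row_full_unit.
Qed.

Section Height.
Variables (R : realType) (k : finFieldType).
Local Notation F := (laurent k).
Local Notation O := (power_series k).
Local Notation ps := (@power_series_laurent k).
Local Notation pl := (@poly_laurent k).
Local Notation s := (ps (ps_var k)).
Local Notation q := (#|k|%:R : R).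
Variable D : nat.
Local Notation d := D.+1.

Lemma labs_s : labs R s = q^-1.
Proof. by rewrite labs_ps ?ps_var_neq0 // ps_ord_var expr1. Qed.

Lemma labs_det_diag_pow (n : nat) (b : 'I_n -> nat) :
  labs R (\det (diag_pow k b)) = q ^- (\sum_i b i).
Proof.
rewrite det_diag labs_prod -exprVn -prodrXr; apply: eq_bigr => i _.
by rewrite mxE labsX labs_s.
Qed.

Section DecomposedHeight.
Variables (A : GL F d) (c : F) (C : 'M[{poly k}]_d) (b : 'I_d -> nat) (B : 'M[O]_d).
Hypotheses (c0 : c != 0) (Cu : C \in unitmx) (Bu : B \in unitmx).
Hypothesis AE : GLmx A = c *: (map_mx pl C *m diag_pow k b *m map_mx ps B).

Lemma covol_decomposed : covol R (A^-1)%g = labs R c ^- d * q ^+ (\sum_i b i).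
Proof.
rewrite /covol /= det_inv labsV AE detZ !det_mulmx !labsM labsX.
by rewrite (labs_det_pl R Cu) (labs_det_ps R Bu) labs_det_diag_pow mul1r mulr1 invfM invrK.
Qed.

(** A largest minor of [B V], times the diagonal entries of its rows, equals [c^-j] times a
    polynomial minor. The latter is nonzero, hence at least 1 in absolute value. *)
Lemma wedge_norm_lattice_ge (j : nat) (V : 'M[F]_(d, j)) :
  {homo b : x y / (x <= y)%N} ->
  (forall i, lattice (A^-1)%g (col i V)) -> row_free V^T ->
  labs R c ^- j * q ^+ (\sum_(i < d | (i < j)%N) b i) <= wedge_norm R V.
Proof.
move=> b_homo /fin_all_exists2[w _ wE] Vfree.
pose W : 'M[{poly k}]_(d, j) := \matrix_(a, i) w i a 0.
have VE : GLmx A *m V = map_mx pl W.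
  have -> : V = GLmx (A^-1)%g *m map_mx pl W.
    apply/matrixP => a i; have /(congr1 (fun M : 'cV[F]_d => M a 0)) := wE i.
    by rewrite [in RHS]mxE => <-; rewrite !mxE; apply: eq_bigr => l _; rewrite !mxE.
  by rewrite /= mulKVmx ?Defs.GL_unit.
pose V' := map_mx ps B *m V.
have V'free : row_free V'^T.
  by have := row_free_tr_mulmx (unitmx_map_mx ps Bu) Vfree.
apply: le_trans (wedge_norm_map_le R B V).
have wn0 := wedge_norm_gt0 R V'free.
have [f [f_incr wnE]] := wedge_norm_attained wn0.
have fE : \det (diag_pow k (b \o f)) * \det (rowsub f V') =
    c^-1 ^+ j * pl (\det (rowsub f (invmx C *m W))).
  rewrite -det_mulmx -det_map_mx -detZ; congr (\det _).
  have : diag_pow k b *m V' = c^-1 *: map_mx pl (invmx C *m W).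
    rewrite map_mxM -VE AE -!scalemxAl -scalemxAr scalerA mulVf // scale1r.
    by rewrite !mulmxA -map_mxM (mulVmx Cu) map_mx1 mul1mx.
  move=> /matrixP e; clearbody V'; apply/matrixP => a i.
  by have := e (f a) i; rewrite /diag_pow !mul_diag_mx !mxE => ->.
move/(congr1 (labs R (k:=k))): fE; rewrite !labsM labs_det_diag_pow wnE labsX labsV => fE.
have qS (n : nat) : 0 < q ^+ n by rewrite exprn_gt0 ?card_field_gt0.
have minor0 : \det (rowsub f (invmx C *m W)) != 0.
  apply: contraTneq wn0 => w0; move: fE; rewrite w0 rmorph0 labs0 mulr0 => /eqP.
  by rewrite mulf_eq0 invr_eq0 gt_eqF //= => /eqP->; rewrite ltxx.
(* The chosen rows satisfy [i <= f i], so monotone exponents sum to least over the first [j]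
   rows. *)
have le_S : (\sum_(i < d | (i < j)%N) b i <= \sum_(i < j) b (f i))%N.
  have le_jd : (j <= d)%N by rewrite (leq_trans _ (rank_leq_row V)) // -mxrank_tr (eqP Vfree).
  rewrite (big_ord_narrow le_jd); apply: leq_sum => i _; apply: b_homo.
  exact: increasing_ord_ge f_incr i.
have -> : wedge_norm R V' = labs R c ^- j * q ^+ (\sum_i b (f i)) *
    labs R (pl (\det (rowsub f (invmx C *m W)))).
  by rewrite mulrAC -exprVn -fE mulrC mulrA mulfV ?mul1r // gt_eqF.
rewrite -[leLHS]mulr1; apply: ler_pM; rewrite ?ler01 ?labs_poly_ge1 //.
  by apply: mulr_ge0; rewrite ?invr_ge0 ?exprn_ge0 ?labs_ge0 // ltW ?qS.
rewrite ler_wpM2l ?invr_ge0 ?exprn_ge0 ?labs_ge0 // ler_eXn2l ?card_field_gt1 //.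
Qed.

End DecomposedHeight.
End Height.

(** * The exponents [H_j] and [N] *)

Section Exponents.
Variables (d : nat).
Implicit Type b : 'I_d -> nat.

(** This is [H_j]. For monotone [b] it equals [j] times the sum of all [b i] minus [d] times the sum
    of the first [j]. *)
Definition cut_exp b (j : nat) : nat :=
  (\sum_(i' < d) \sum_(i < d | i < j <= i') (b i' - b i))%N.

Definition pair_exp b : nat := (\sum_(i' < d) \sum_(i < d) (b i' - b i))%N.

Lemma sum_ord_lt_const (j c : nat) : (j <= d)%N -> (\sum_(i < d | i < j) c = j * c)%N.
Proof. by move=> le_jd; rewrite (big_ord_narrow le_jd) sum_nat_const card_ord. Qed.

(** After splitting at [j], the pairs with both indices below [j] cancel; the others compare by
    [b i' <= (b i' - b i) + b i]. *)
Lemma cut_exp_ge b (j : nat) : (j <= d)%N ->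
  (j * \sum_i b i <= cut_exp b j + d * \sum_(i < d | i < j) b i)%N.
Proof.
move=> le_jd.
have -> : cut_exp b j = (\sum_(i < d | i < j) \sum_(i' < d | j <= i') (b i' - b i))%N.
  rewrite /cut_exp (exchange_big_dep (fun i : 'I_d => (i < j)%N)) => [|i' i _ /andP[]] //=.
  by apply: eq_bigr => i lt_ij; apply: eq_bigl => i'; rewrite lt_ij.
have -> : (d * \sum_(i < d | i < j) b i = \sum_(i < d | i < j) \sum_(i' < d) b i)%N.
  by rewrite big_distrr /=; apply: eq_bigr => i _; rewrite sum_nat_const card_ord.
rewrite -(sum_ord_lt_const _ le_jd).
have split_j (f : 'I_d -> 'I_d -> nat) :
    (\sum_(i < d | i < j) \sum_(i' < d) f i i' =
     \sum_(i < d | i < j) \sum_(i' < d | i' < j) f i i' +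
     \sum_(i < d | i < j) \sum_(i' < d | j <= i') f i i')%N.
  rewrite -big_split /=; apply: eq_bigr => i _.
  rewrite (bigID (fun i' : 'I_d => (i' < j)%N)) /=; congr (_ + _)%N.
  by apply: eq_bigl => i'; rewrite -leqNgt.
rewrite (split_j (fun _ i' => b i')) (split_j (fun i _ => b i)).
rewrite [X in (X + _ <= _)%N]exchange_big /=.
rewrite addnCA leq_add2l -big_split /=; apply: leq_sum => i _.
by rewrite -big_split /=; apply: leq_sum => i' _; rewrite addnC -leq_subLR.
Qed.

Lemma cut_exp_ge_dim b (j : nat) : (d <= j)%N -> cut_exp b j = 0%N.
Proof.
move=> le_dj; apply: big1 => i' _; apply: big1 => i /andP[_ le_ji'].
by have := ltn_ord i'; lia.
Qed.

End Exponents.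

(** * Heights compared with [H_j], and the height at [(0, m, ..., m)] *)

Section HeightBounds.
Variables (R : realType) (k : finFieldType).
Local Notation F := (laurent k).
Local Notation O := (power_series k).
Local Notation ps := (@power_series_laurent k).
Local Notation pl := (@poly_laurent k).
Local Notation s := (ps (ps_var k)).
Local Notation q := (#|k|%:R : R).
Variable D : nat.
Local Notation d := D.+1.
Variables (A : GL F d) (c : F) (C : 'M[{poly k}]_d) (b : 'I_d -> nat) (B : 'M[O]_d).
Hypotheses (c0 : c != 0) (Cu : C \in unitmx) (Bu : B \in unitmx).
Hypothesis AE : GLmx A = c *: (map_mx pl C *m diag_pow k b *m map_mx ps B).

Lemma height_gt_cut (T : R) : {homo b : x y / (x <= y)%N} -> 1 <= T ->
  (T%:E < height R (A^-1)%g)%E ->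
  exists j, (0 < j < d)%N /\ T ^+ d < q ^+ cut_exp b j.
Proof.
move=> b_homo T1 /ereal_sup_gt[_ [j [V [/andP[j0 le_jd] Vlat Vfree ->]]]].
have wn0 := wedge_norm_gt0 R Vfree.
have := wedge_norm_lattice_ge R c0 Cu Bu AE b_homo Vlat Vfree.
have lc0 : 0 < labs R c by exact: labs_gt0.
have qS (n : nat) : 0 < q ^+ n by rewrite exprn_gt0 ?card_field_gt0.
set S := (\sum_(i < d | (i < j)%N) b i)%N => wn_ge.
have cov0 : 0 <= labs R c ^- d * q ^+ (\sum_i b i).
  by apply: mulr_ge0; rewrite ?invr_ge0 ?exprn_ge0 // ltW.
have T0 : 0 <= T := le_trans ler01 T1.
rewrite lte_fin ltr_pdivlMr // (covol_decomposed R Cu Bu AE).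
rewrite (lt_powR_div _ _ cov0) ?mulr_ge0 ?(ltW wn0) //.
rewrite exprMn => lt_cov.
(* Inserting the lower bound for the wedge norm leaves the same power of [labs R c] on both sides,
   which then cancels. *)
have {}lt_cov : T ^+ d * (labs R c ^- j * q ^+ S) ^+ d < (labs R c ^- d * q ^+ (\sum_i b i)) ^+ j.
  apply: le_lt_trans lt_cov; rewrite ler_wpM2l ?exprn_ge0 //.
  rewrite ler_pXn2r ?nnegrE ?(ltW wn0) //; apply: mulr_ge0; rewrite ?invr_ge0 ?exprn_ge0 // ltW //.
move: lt_cov; rewrite !exprMn !exprVn -!exprM mulrCA [(d * j)%N]mulnC.
rewrite ltr_pM2l ?invr_gt0 ?exprn_gt0 // => lt_q.
have le_q : q ^+ ((\sum_i b i) * j) <= q ^+ cut_exp b j * q ^+ (S * d).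
  rewrite -exprD ler_eXn2l ?card_field_gt1 //.
  by have := cut_exp_ge b le_jd; rewrite -/S (mulnC j) (mulnC d).
have lt_T : T ^+ d < q ^+ cut_exp b j.
  by rewrite -(ltr_pM2r (qS (S * d)%N)) (lt_le_trans lt_q).
(* For [j = d] the cut exponent is zero, and [T ^+ d < 1] contradicts [1 <= T]. *)
exists j; split=> //; rewrite j0 /= ltnNge; apply/negP => le_dj.
by move: lt_T; rewrite cut_exp_ge_dim // expr0 ltNge exprn_ege1.
Qed.

Lemma height_cusp_gt (m : nat) (T : R) : b = cusp_exp m -> 0 <= T ->
  T ^+ d < q ^+ (m * D) -> (T%:E < height R (A^-1)%g)%E.
Proof.
move=> bE T0 lt_T.
have lc0 : 0 < labs R c by exact: labs_gt0.
pose e0 : 'cV[F]_d := delta_mx ord0 ord0.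
(* The short lattice vector: the diagonal fixes [e0], so [A] sends this vector to the first column
   of [C], while its norm is at most that of [c^-1 e0]. *)
pose V : 'M[F]_(d, 1) := map_mx ps (invmx B) *m (c^-1 *: e0).
have De0 : diag_pow k b *m e0 = e0.
  apply/matrixP => i z; rewrite mul_diag_mx !mxE bE /cusp_exp ord1.
  by case: (eqVneq i ord0) => _ /=; rewrite ?expr0 ?mul1r // !mulr0.
have AV : GLmx A *m V = map_mx pl (C *m delta_mx ord0 ord0).
  rewrite AE -scalemxAl /V -!scalemxAr scalerA mulfV // scale1r mulmxA.
  rewrite -[X in X *m e0]mulmxA -map_mxM (mulmxV Bu) map_mx1 mulmx1 -mulmxA De0.
  rewrite map_mxM; congr (_ *m _).
  by apply/matrixP => i z; rewrite !mxE rmorph_nat.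
have VE : V = GLmx (A^-1)%g *m map_mx pl (C *m delta_mx ord0 ord0).
  by rewrite -AV /= mulKmx ?Defs.GL_unit.
have Vlat i : lattice (A^-1)%g (col i V).
  exists (C *m delta_mx ord0 ord0) => //; rewrite -VE; apply/matrixP => a z.
  by rewrite !mxE !ord1.
have Vfree : row_free V^T.
  apply: row_free_tr_mulmx.
    by have := @unitmx_map_mx k d _ ps (invmx B); rewrite unitmx_inv; apply.
  by rewrite /row_free mxrank_tr mxrank_scale_nz ?invr_neq0 // mxrank_delta.
have wn0 := wedge_norm_gt0 R Vfree.
have wn_le : wedge_norm R V <= (labs R c)^-1.
  apply: le_trans (wedge_norm_map_le R (invmx B) _) _.
  apply: bigmax_le => [|f _]; first by rewrite invr_ge0 ltW.
  rewrite det_mx11 !mxE labsM labsV ler_piMr ?invr_ge0 ?(ltW lc0) //.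
  by case: eqP => _; rewrite ?labs1 // labs0.
apply: (@lt_le_trans _ _ ((covol R (A^-1)%g `^ (1%:R / d%:R) / wedge_norm R V)%:E)%E); last first.
  by apply: ereal_sup_ubound; exists 1%N, V; split.
rewrite lte_fin ltr_pdivlMr // (covol_decomposed R Cu Bu AE).
have sb : (\sum_i b i = m * D)%N.
  rewrite bE big_ord_recl /= add0n.
  by under eq_bigr => i _ do rewrite /cusp_exp /=; rewrite sum_nat_const card_ord mulnC.
rewrite lt_powR_div ?mulr_ge0 ?invr_ge0 ?exprn_ge0 ?(ltW lc0) ?(ltW wn0) // expr1 sb.
rewrite exprMn mulrC; apply: (@le_lt_trans _ _ (labs R c ^- d * T ^+ d)).
  rewrite ler_wpM2r ?exprn_ge0 // -exprVn ler_pXn2r ?nnegrE ?(ltW wn0) //.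
  by rewrite invr_ge0 ltW.
by rewrite ltr_pM2l // invr_gt0 exprn_gt0.
Qed.

End HeightBounds.

(** * Summation over the double cosets *)

Section Steps.
Variable D : nat.
Local Notation d := D.+1.
Implicit Types b : 'I_d -> nat.

Definition ord_lo (k : 'I_D) : 'I_d := widen_ord (leqnSn D) k.
Definition ord_hi (k : 'I_D) : 'I_d := lift ord0 k.
Definition step b (k : 'I_D) : nat := (b (ord_hi k) - b (ord_lo k))%N.

Lemma val_ord_hi k : ord_hi k = k.+1 :> nat. Proof. by []. Qed.

(** The cut exponent replaces the step across the cut. For [j = 0] no index matches and all
    coordinates are steps, the case used for the total mass. *)
Definition cut_coord (j : nat) b : {ffun 'I_D -> nat} :=
  [ffun k : 'I_D => if k.+1 == j then cut_exp b j else step b k].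

(** Differences telescope into steps. The conclusion is stated additively to avoid truncated
    subtraction. *)
Lemma diff_le_of_step_le b b' : {homo b : x y / (x <= y)%N} -> {homo b' : x y / (x <= y)%N} ->
  (forall k, (step b k <= step b' k)%N) ->
  forall i i' : 'I_d, (i <= i')%N -> (b i' + b' i <= b' i' + b i)%N.
Proof.
move=> b_homo b'_homo le_step i [i' lt_i'] /=; elim: i' lt_i' => [|n IH] lt_n.
  rewrite leqn0 => /eqP i0; have -> : Ordinal lt_n = i by apply: val_inj; rewrite /= i0.
  by rewrite addnC.
rewrite leq_eqVlt => /orP[/eqP e|lt_in].
  by have -> : Ordinal lt_n = i; [apply: val_inj; rewrite /= e | rewrite addnC].
have lt_nD : (n < D)%N by [].
have hiE : ord_hi (Ordinal lt_nD) = Ordinal lt_n by apply: val_inj.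
have loE : ord_lo (Ordinal lt_nD) = Ordinal (ltnW lt_n) by apply: val_inj.
have := IH (ltnW lt_n) lt_in; have := le_step (Ordinal lt_nD).
have := b_homo (Ordinal (ltnW lt_n)) (Ordinal lt_n) (leqnSn n).
have := b'_homo (Ordinal (ltnW lt_n)) (Ordinal lt_n) (leqnSn n).
rewrite /step hiE loE; lia.
Qed.

Lemma eq_of_step_eq b b' : {homo b : x y / (x <= y)%N} -> {homo b' : x y / (x <= y)%N} ->
  b ord0 = 0%N -> b' ord0 = 0%N -> step b =1 step b' -> b =1 b'.
Proof.
move=> b_homo b'_homo b0 b'0 e i.
have h1 :=
  diff_le_of_step_le b_homo b'_homo (fun k => eq_leq (e k)) (leq0n i : (ord0 <= i)%N).
have h2 :=
  diff_le_of_step_le b'_homo b_homo (fun k => eq_leq (esym (e k))) (leq0n i : (ord0 <= i)%N).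
by move: h1 h2; rewrite b0 b'0 !addn0 => h1 h2; apply/eqP; rewrite eqn_leq h1 h2.
Qed.

(** The adjacent pair across the cut contributes exactly the step at [k0] and grows strictly; every
    other crossing pair grows weakly. *)
Lemma cut_exp_lt b b' (j : nat) (k0 : 'I_D) :
  {homo b : x y / (x <= y)%N} -> {homo b' : x y / (x <= y)%N} -> k0.+1 = j ->
  (forall k, (step b k <= step b' k)%N) -> (step b k0 < step b' k0)%N ->
  (cut_exp b j < cut_exp b' j)%N.
Proof.
move=> b_homo b'_homo k0j le_step lt_step; rewrite /cut_exp.
have le_diff (i i' : 'I_d) : (i <= i')%N -> (b i' - b i <= b' i' - b' i)%N.
  move=> le_ii'; have := diff_le_of_step_le b_homo b'_homo le_step le_ii'.
  by have := b_homo _ _ le_ii'; have := b'_homo _ _ le_ii'; lia.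
have kP : (ord_lo k0 < j <= ord_hi k0)%N by rewrite -k0j val_ord_hi !leqnn.
rewrite (bigD1 (ord_hi k0)) //= [X in (_ < X)%N](bigD1 (ord_hi k0)) //=.
rewrite -addSn leq_add //; last first.
  apply: leq_sum => i' _; apply: leq_sum => i /andP[lt_ij le_ji']; apply: le_diff.
  exact: ltnW (leq_trans lt_ij le_ji').
rewrite (bigD1 (ord_lo k0)) //= [X in (_ < X)%N](bigD1 (ord_lo k0)) //=.
rewrite -addSn leq_add //; apply: leq_sum => i /andP[/andP[lt_ij le_ji'] _]; apply: le_diff.
exact: ltnW (leq_trans lt_ij le_ji').
Qed.

(** With the other steps fixed, the cut exponent is strictly increasing in the missing step, hence
    determines it. *)
Lemma cut_coord_inj (j : nat) b b' :
  {homo b : x y / (x <= y)%N} -> {homo b' : x y / (x <= y)%N} ->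
  b ord0 = 0%N -> b' ord0 = 0%N -> cut_coord j b = cut_coord j b' -> b =1 b'.
Proof.
move=> b_homo b'_homo b0 b'0 /ffunP e; apply: eq_of_step_eq => //.
have e_ne (k : 'I_D) : k.+1 != j -> step b k = step b' k.
  by move=> kj; have := e k; rewrite !ffunE (negPf kj).
move=> k; have [kj|/e_ne//] := eqVneq k.+1 j.
have := e k; rewrite !ffunE kj eqxx => ecut.
have ne_k (l : 'I_D) : l != k -> step b l = step b' l.
  by move=> lk; apply: e_ne; rewrite -kj eqSS.
have [lt|lt|//] := ltngtP (step b k) (step b' k).
- have : (cut_exp b j < cut_exp b' j)%N.
    apply: (cut_exp_lt b_homo b'_homo kj) => // l.
    by have [->|/ne_k->//] := eqVneq l k; exact: ltnW.
  by rewrite ecut ltnn.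
- have : (cut_exp b' j < cut_exp b j)%N.
    apply: (cut_exp_lt b'_homo b_homo kj) => // l.
    by have [->|/ne_k->//] := eqVneq l k; exact: ltnW.
  by rewrite ecut ltnn.
Qed.

(** The pairs crossing the cut and the adjacent pairs at the other positions are disjoint families
    of pairs counted by [pair_exp]. *)
Lemma sum_cut_coord_le (j : nat) b :
  (\sum_k cut_coord j b k <= pair_exp b)%N.
Proof.
rewrite /pair_exp.
have -> : (\sum_k cut_coord j b k = \sum_(k < D | k.+1 == j) cut_exp b j +
    \sum_(k : 'I_D | k.+1 != j) step b k)%N.
  rewrite (bigID (fun k : 'I_D => k.+1 == j)) /=; congr (_ + _)%N.
    by apply: eq_bigr => k kj; rewrite ffunE kj.
  by apply: eq_bigr => k kj; rewrite ffunE (negPf kj).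
have le_cut : (\sum_(k < D | k.+1 == j) cut_exp b j <= cut_exp b j)%N.
  have [/existsP[k /eqP kj]|/existsPn none] := boolP [exists k : 'I_D, k.+1 == j].
    by rewrite (big_pred1 k) // => l /=; rewrite -kj eqSS.
  by rewrite big_pred0 // => l; apply/negbTE.
apply: leq_trans (leq_add le_cut (leqnn _)) _.
rewrite /cut_exp !big_ord_recl /= big_pred0 ?add0n; last first.
  by move=> i; case: j {le_cut} => // j; rewrite andbF.
apply: leq_trans (leq_addl _ _).
rewrite [X in (_ + X <= _)%N]big_mkcond -big_split /=; apply: leq_sum => k _.
rewrite [X in (_ <= X)%N](bigID (fun i : 'I_d => (i < j <= ord_hi k)%N)) /= leq_add2l.
case: ifP => // kj; rewrite (bigD1 (ord_lo k)) ?leq_addr //=.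
by rewrite /bump leq0n; move: kj => /eqP /=; lia.
Qed.

End Steps.

(** * Geometric tails and sums over several coordinates *)

Section GeometricSums.
Variable R : realType.
Implicit Type q r : R.

Definition tail_pow q r (n : nat) : R := if r < q ^+ n then q ^- n else 0.

Lemma tail_pow_ge0 q r n : 0 <= q -> 0 <= tail_pow q r n.
Proof. by move=> q0; rewrite /tail_pow; case: ifP => // _; rewrite invr_ge0 exprn_ge0. Qed.

Lemma sum_invX_le q N : 2 <= q -> \sum_(n < N) q ^- n <= 2.
Proof.
move=> q2; have q0 : 0 < q by lra.
elim: N => [|N IH]; first by rewrite big_ord0.
rewrite big_ord_recl expr0 invr1.
under eq_bigr => i _ do rewrite /= /bump /= add1n exprS invfM.
rewrite -mulr_sumr.
have qi : q^-1 <= 2^-1 by rewrite lef_pV2 ?posrE.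
have S0 : 0 <= \sum_(i < N) q ^- i.
  by apply: sumr_ge0 => i _; rewrite invr_ge0 exprn_ge0 // ltW.
have qi0 : 0 <= q^-1 by rewrite invr_ge0 ltW.
have : q^-1 * (\sum_(i < N) q ^- i) <= 2^-1 * 2 by exact: ler_pM.
by rewrite mulVf //; lra.
Qed.

Lemma sum_tail_pow_le q r N : 2 <= q -> 0 < r -> \sum_(n < N) tail_pow q r n <= 2 / r.
Proof.
move=> q2; have q0 : 0 < q by lra.
elim: N r => [|N IH] r r0; first by rewrite big_ord0 divr_ge0 // ltW.
(* For [r < 1] the whole series is at most [2 <= 2 / r]. For [1 <= r] the term at 0 vanishes, and
   shifting the index replaces [r] by [r / q]. *)
have [r1|r1] := leP 1 r; last first.
  apply: le_trans (_ : 2 <= _); last first.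
    by rewrite ler_pdivlMr // ler_piMr // ltW.
  apply: le_trans (sum_invX_le N.+1 q2); apply: ler_sum => n _.
  by rewrite /tail_pow; case: ifP => // _; rewrite invr_ge0 exprn_ge0 // ltW.
rewrite big_ord_recl {1}/tail_pow expr0 ltNge r1 /= add0r.
have -> : \sum_(i < N) tail_pow q r (bump 0 i) = q^-1 * \sum_(i < N) tail_pow q (r / q) i.
  rewrite mulr_sumr; apply: eq_bigr => i _; rewrite /tail_pow /bump /= add1n.
  by rewrite exprS ltr_pdivrMr // [q * _]mulrC; case: ifP => _; rewrite ?mulr0 // invfM mulrC.
have rq0 : 0 < r / q by exact: divr_gt0.
have -> : 2 / r = q^-1 * (2 / (r / q)) by field; rewrite !gt_eqF.
by rewrite ler_pM2l ?invr_gt0 // IH.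
Qed.

End GeometricSums.

(** A finite subfamily embeds through [f] into a box, over which the sum of products factors into
    one-variable sums. *)
Lemma esum_prod_bound (R : realType) (D : nat) (I : choiceType) (S : set I)
    (m : I -> R) (f : I -> {ffun 'I_D -> nat}) (F : 'I_D -> nat -> R) (C : 'I_D -> R) :
  (forall k n, 0 <= F k n) -> (forall k N, \sum_(n < N) F k n <= C k) ->
  (forall x y, S x -> S y -> f x = f y -> x = y) ->
  (forall x, S x -> m x <= \prod_k F k (f x k)) ->
  (\esum_(x in S) (m x)%:E <= (\prod_k C k)%:E)%E.
Proof.
move=> F0 FC f_inj mF; apply: ub_ereal_sup => _ [X [finX XS] <-].
rewrite fsbig_finite // sumEFin lee_fin.
pose N := (\max_(x <- fset_set X) \max_k f x k)%N.
have fN x k : x \in fset_set X -> (f x k < N.+1)%N.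
  move=> xX; rewrite ltnS.
  apply: leq_trans (leq_bigmax_seq (F := fun x => (\max_k f x k)%N) x xX isT).
  exact: (leq_bigmax k).
pose g x : {ffun 'I_D -> 'I_N.+1} := [ffun k => inord (f x k)].
have gE x k : x \in fset_set X -> g x k = f x k :> nat.
  by move=> xX; rewrite ffunE inordK ?fN.
pose G (h : {ffun 'I_D -> 'I_N.+1}) := \prod_k F k (h k).
have G0 h : 0 <= G h by apply: prodr_ge0.
apply: (@le_trans _ _ (\sum_(x <- fset_set X) G (g x))).
  rewrite big_seq [leRHS]big_seq; apply: ler_sum => x xX.
  have Sx : S x by apply: XS; move: xX; rewrite in_fset_set // inE.
  apply: le_trans (mF x Sx) _; rewrite le_eqVlt; apply/orP; left; apply/eqP.
  by apply: eq_bigr => k _; rewrite gE.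
rewrite -(big_map g xpredT G) big_uniq /=; last first.
  rewrite map_inj_in_uniq // => x y xX yX /ffunP e.
  have [Sx Sy] : S x /\ S y by split; apply: XS; [move: xX|move: yX]; rewrite in_fset_set // inE.
  by apply: f_inj => //; apply/ffunP => k; rewrite -!gE // e.
apply: (@le_trans _ _ (\sum_h G h)).
  rewrite [leRHS](bigID (mem [seq g x | x <- fset_set X])) /= lerDl.
  by apply: sumr_ge0.
rewrite -(bigA_distr_bigA (fun k (n : 'I_N.+1) => F k n)).
by apply: ler_prod => k _; rewrite FC andbT sumr_ge0.
Qed.

Lemma card_fset_set_image (T U : choiceType) (f : T -> U) (S : set T) :
  injective f -> #|` fset_set [set f x | x in S]| = #|` fset_set S|.
Proof.
move=> f_inj; have [finS|infS] := pselect (finite_set S).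
  by rewrite fset_set_image // card_imfset.
(* If [S] is infinite, so is its image, and both cardinalities take the default value zero. *)
have infS' : ~ finite_set [set f x | x in S].
  have fS : {in S &, injective f} by move=> x y _ _; exact: f_inj.
  by have /card_eqPle[_ h] := inj_card_eq fS => /(card_le_finite h).
by rewrite /fset_set; do 2 case: pselect => //.
Qed.

(** * Masses of double cosets and their sums *)

Section Mass.
Variables (R : realType) (k : finFieldType) (D : nat).
Local Notation F := (laurent k).
Local Notation q := (#|k|%:R : R).
Local Notation d := D.+1.
Local Notation piG := (\pi_(PGL F d))%qT.
Implicit Types y : Y k d.

Definition mass y : R := #|` fset_set (stab (repr y))|%:R^-1.

Definition exponents y (b : 'I_d -> nat) : Prop :=
  [/\ {homo b : i j / (i <= j)%N}, b ord0 = 0%N & dcoset_rel (piG (gdiag k b)) (repr y)].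

Lemma repr_decomposed y b : dcoset_rel (piG (gdiag k b)) (repr y) ->
  exists (c : F) (C : 'M[{poly k}]_d) (B : 'M[power_series k]_d),
    [/\ c != 0, C \in unitmx, B \in unitmx &
        GLmx (repr (repr y : PGL F d)) =
        c *: (map_mx (@poly_laurent k) C *m diag_pow k b *m map_mx (@power_series_laurent k) B)].
Proof. by move=> h; apply/dcoset_gdiagP; rewrite reprK. Qed.

Lemma exponents_exist y : exists b, exponents y b.
Proof.
have [c [C [b [B [[c0 Cu Bu] b_homo b0 e]]]]] :=
  GL_decomposition (Defs.GL_unit (repr (repr y : PGL F d))).
exists b; split=> //; rewrite -[repr y]reprK; apply/dcoset_gdiagP.
by exists c, C, B.
Qed.

Lemma exponents_inj y y' b : exponents y b -> exponents y' b -> y = y'.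
Proof.
move=> [_ _ h] [_ _ h']; rewrite -[y]reprK -[y']reprK; apply/eqmodP => /=.
by apply: dcoset_trans h'; rewrite dcoset_sym.
Qed.

Lemma card_stab_repr y b : dcoset_rel (piG (gdiag k b)) (repr y) ->
  #|` fset_set (stab (repr y))| = #|` fset_set (stab (piG (gdiag k b)))|.
Proof. by move=> /stab_dcoset[a ->]; apply: card_fset_set_image; exact: conj_inj. Qed.

Lemma mass_le y b : exponents y b -> mass y <= q ^- pair_exp b.
Proof.
move=> [b_homo _ /card_stab_repr]; rewrite /mass => ->.
have q0 := card_field_gt0 R k.
have [fin|inf] := pselect (finite_set (stab (piG (gdiag k b)))); last first.
  (* [fset_set] of an infinite set is empty and [0^-1 = 0]. *)
  by rewrite /fset_set; case: pselect => // _; rewrite cardfs0 invr0 invr_ge0 exprn_ge0 // ltW.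
have le_card := stab_gdiag_ge R b_homo fin.
rewrite lef_pV2 ?posrE ?exprn_gt0 //; first by rewrite -natrX ler_nat.
by rewrite ltr0n (leq_trans _ le_card) // expn_gt0 -(ltr0n R) q0.
Qed.

Lemma mass_cusp_ge y m : dcoset_rel (piG (gdiag k (cusp_exp m))) (repr y) ->
  q ^- (d ^ 2 + m * D) <= mass y.
Proof.
move=> /card_stab_repr; rewrite /mass => ->.
have [fin le_card] := stab_cusp_le R k D m.
have q0 := card_field_gt0 R k.
rewrite lef_pV2 ?posrE ?exprn_gt0 //; first by rewrite -natrX ler_nat.
rewrite ltr0n cardfs_gt0; apply/fset0Pn; exists 1%g; rewrite in_fset_set // inE.
split; first exact: PGL_image1.
by exists 1%g; [exact: PGL_image1 | rewrite mulg1 mulgV].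
Qed.

Lemma nu_cut_le (S : set (Y k d)) (bb : Y k d -> 'I_d -> nat) (j : nat) (r : R) :
  (forall y, exponents y (bb y)) -> 0 < r -> (j <= D)%N ->
  (forall y, S y -> (0 < j)%N -> r < q ^+ cut_exp (bb y) j) ->
  (nu R S <= (4 ^+ D * (if (0 < j)%N then r^-1 else 1))%:E)%E.
Proof.
move=> bbP r0 le_jD rS.
have q0 := card_field_gt0 R k.
have q2 : 2 <= q by rewrite ler_nat card_finNzRing_gt1.
(* Every power [q ^+ n] exceeds [1/2], so this threshold imposes nothing on the step coordinates and
   costs a factor [2 / (1/2) = 4] each. *)
pose rr (l : 'I_D) := if l.+1 == j then r else 2^-1.
have rr0 l : 0 < rr l by rewrite /rr; case: ifP => // _; rewrite invr_gt0.
have := @esum_prod_bound R D (Y k d) S mass (fun y => cut_coord j (bb y))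
  (fun l => tail_pow q (rr l)) (fun l => 2 / rr l).
move=> /(_ _ _ _ _)/le_trans; apply.
- by move=> l n; apply: tail_pow_ge0; exact: ltW.
- by move=> l N; exact: sum_tail_pow_le.
- move=> y y' Sy Sy' e; have [h0 h1 h2] := bbP y; have [h0' h1' h2'] := bbP y'.
  have bE : bb y = bb y' by apply/funext; exact: (cut_coord_inj h0 h0' h1 h1' e).
  by apply: (@exponents_inj _ _ (bb y)); [|rewrite bE].
- move=> y Sy; apply: le_trans (mass_le (bbP y)) _.
  have -> : \prod_l tail_pow q (rr l) (cut_coord j (bb y) l) =
      q ^- (\sum_l cut_coord j (bb y) l).
    rewrite -exprVn -prodrXr; apply: eq_bigr => l _; rewrite exprVn /tail_pow.
    suff -> : rr l < q ^+ cut_coord j (bb y) l by [].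
    rewrite /rr ffunE; case: eqP => [lj|_]; first by apply: rS; rewrite // -lj.
    by apply: (@lt_le_trans _ _ 1); [lra | rewrite exprn_ege1 //; lra].
  rewrite lef_pV2 ?posrE ?exprn_gt0 // ler_weXn2l ?sum_cut_coord_le //; lra.
rewrite lee_fin.
case: j le_jD rS @rr rr0 => [|j] le_jD rS rr rr0 /=.
  have -> : 4 ^+ D = \prod_(l < D) 4 :> R by rewrite prodr_const card_ord.
  rewrite mulr1.
  by apply: ler_prod => l _; rewrite /rr /=; apply/andP; split; lra.
pose j0 := Ordinal le_jD.
rewrite (bigD1 j0) //= {1}/rr eqxx.
have -> : 4 ^+ D / r = (2 / r) * (2 * 4 ^+ D.-1) :> R.
  by rewrite -[in LHS](ltn_predK le_jD) exprS; field; rewrite gt_eqF.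
apply: ler_pM => //; first by rewrite divr_ge0 // ltW.
  by apply: prodr_ge0 => l _; rewrite divr_ge0 // ltW.
have -> : \prod_(l < D | l != j0) (2 / rr l) = 4 ^+ D.-1.
  under eq_bigr => l lj0.
    have -> : 2 / rr l = 4 by rewrite /rr eqSS -[_ == j]/(l == j0) (negPf lj0); lra.
    over.
  by rewrite prodr_const cardC1 card_ord.
by rewrite ler_peMl ?exprn_ge0 //; lra.
Qed.

End Mass.

(** * Bounds for superlevel sets and for the total mass *)

Section Tail.
Variables (R : realType) (k : finFieldType) (D : nat).
Hypothesis D_gt0 : (0 < D)%N.
Local Notation F := (laurent k).
Local Notation q := (#|k|%:R : R).
Local Notation d := D.+1.
Local Notation piG := (\pi_(PGL F d))%qT.

Lemma mass_ge0 (y : Y k d) : 0 <= mass R y.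
Proof. by rewrite invr_ge0 ler0n. Qed.

Lemma exists_high_point (T : R) : 1 <= T ->
  exists2 y : Y k d, superlevel k d T y & q ^- (d ^ 2 + D) * T ^- d <= mass R y.
Proof.
move=> T1; have T0 : 0 < T := lt_le_trans ltr01 T1.
have q1 := card_field_gt1 R k; have q0 := card_field_gt0 R k.
have ex_m : exists m, T ^+ d < q ^+ (m * D).
  exists (Num.bound (T ^+ d)).
  apply: lt_le_trans (archi_boundP _) _; first by rewrite exprn_ge0 // ltW.
  apply: (@le_trans _ _ (q ^+ Num.bound (T ^+ d))).
    rewrite -natrX ler_nat ltnW // ltn_expl //; exact: card_finNzRing_gt1.
  by rewrite ler_weXn2l ?(ltW q1) // leq_pmulr.
case: (ex_minnP ex_m) => m lt_m m_min.
pose y : Y k d := \pi_(Y k d)%qT (piG (gdiag k (cusp_exp m))).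
have yP : dcoset_rel (piG (gdiag k (cusp_exp m))) (repr y).
  by have /eqmodP : \pi_(Y k d)%qT (piG (gdiag k (cusp_exp m))) = \pi_(Y k d)%qT (repr y)
    by rewrite reprK.
exists y.
  have [c [C [B [c0 Cu Bu e]]]] := repr_decomposed yP.
  exact: (height_cusp_gt c0 Cu Bu e erefl (ltW T0) lt_m).
apply: le_trans (mass_cusp_ge R yP).
case: m lt_m m_min {y yP} => [|m] lt_m m_min.
  by move: lt_m; rewrite expr0 ltNge exprn_ege1.
(* Minimality: the predecessor exponent fails, so overshooting [T ^+ d] costs at most a factor
   [q ^+ D] in the mass. *)
have le_T : q ^+ (m * D) <= T ^+ d.
  by rewrite leNgt; apply/negP => /m_min; rewrite ltnn.
rewrite mulSn addnA [q ^+ (_ + m * D)]exprD invfM ler_wpM2l ?invr_ge0 ?exprn_ge0 ?(ltW q0) //.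
by rewrite lef_pV2 ?posrE ?exprn_gt0.
Qed.

Lemma mass_le_nu (S : set (Y k d)) y : S y -> ((mass R y)%:E <= nu R S)%E.
Proof.
move=> Sy; apply: esum_ge; exists [set y]; last by rewrite fsbig_set1.
by split; [exact: finite_set1 | move=> _ ->].
Qed.

Lemma nu_superlevel_ge (T : R) : 1 <= T ->
  ((q ^- (d ^ 2 + D) * T ^- d)%:E <= nu R (superlevel k d T))%E.
Proof.
by move=> /exists_high_point[y Sy le_y]; apply: le_trans (mass_le_nu Sy); rewrite lee_fin.
Qed.

Lemma nu_superlevel_le (T : R) : 1 <= T ->
  (nu R (superlevel k d T) <= (D%:R * 4 ^+ D * T ^- d)%:E)%E.
Proof.
move=> T1; have T0 : 0 < T := lt_le_trans ltr01 T1.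
have /choice[bb bbP] := @exponents_exist k D.
(* Index [j] stands for the cut [j.+1], so these sets cover the cuts 1 to [D]; the union bound over
   them gives the factor [D]. *)
pose S (j : 'I_D) := [set y | T ^+ d < q ^+ cut_exp (bb y) j.+1].
pose E := superlevel k d T.
have mass_cover y : E y ->
    ((mass R y)%:E <= \sum_(j < D) (if y \in S j then (mass R y)%:E else 0))%E.
  move=> Ey; have [b_homo _ h] := bbP y.
  have [c [C [B [c0 Cu Bu e]]]] := repr_decomposed h.
  have [j [/andP[j0 lt_jd] lt_T]] := height_gt_cut c0 Cu Bu e b_homo T1 Ey.
  have lt_jD : (j.-1 < D)%N by rewrite -ltnS prednK.
  rewrite (bigD1 (Ordinal lt_jD)) //= ifT; last by rewrite inE /S /= prednK.
  by rewrite leeDl // sume_ge0 // => l _; case: ifP; rewrite // lee_fin mass_ge0.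
apply: le_trans (le_esum mass_cover) _.
rewrite esum_sum => [|y j _ _]; last by case: ifP; rewrite // lee_fin mass_ge0.
have -> : (D%:R * 4 ^+ D * T ^- d)%:E = (\sum_(j < D) (4 ^+ D * T ^- d)%:E)%E.
  by rewrite sumEFin sumr_const card_ord -(mulr_natl (4 ^+ D * T ^- d) D) mulrA.
apply: lee_sum => j _; rewrite -esum_mkcondr.
apply: (nu_cut_le bbP (exprn_gt0 d T0) (ltn_ord j : (j.+1 <= D)%N)) => y [_ Sy] _.
exact: Sy.
Qed.

Lemma nu_setT_bounds : (0 < nu R [set: Y k d] < +oo)%E.
Proof.
apply/andP; split.
  have [y _ le_y] := exists_high_point (lexx 1).
  apply: lt_le_trans (mass_le_nu (y := y) I); rewrite lte_fin; apply: lt_le_trans le_y.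
  by rewrite expr1n invr1 mulr1 invr_gt0 exprn_gt0 ?card_field_gt0.
have /choice[bb bbP] := @exponents_exist k D.
(* Cut position 0 makes the height condition vacuous and bounds the whole mass. *)
apply: le_lt_trans (nu_cut_le bbP ltr01 (leq0n D) _) (ltry _).
by [].
Qed.

End Tail.

Theorem theorem4p1 (R : realType) (p e d : nat)
    (p_prime : prime p) (e_gt0 : (0 < e)%N) (d_ge2 : (2 <= d)%N) :
  exists A1 A2 : R, [/\ 0 < A1, A1 <= A2 &
    forall k : finFieldType, #|k| = (p ^ e)%N ->
    [/\ (forall T : R, 1 <= T ->
          ((A1 * T ^- d)%:E <= nu R (superlevel k d T) <= (A2 * T ^- d)%:E)%E),
        (0 < nu R [set: Y k d] < +oo)%E &
        (forall T : R, 1 <= T ->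
          (A1%:E / nu R [set: Y k d] * (T ^- d)%:E
             <= mu R (superlevel k d T)
             <= A2%:E / nu R [set: Y k d] * (T ^- d)%:E)%E)]].
Proof.
case: d d_ge2 => // D; rewrite ltnS => D_gt0.
pose q : R := (p ^ e)%:R.
have q1 : 1 <= q by rewrite ler1n expn_gt0 prime_gt0.
have q0 : 0 < q by exact: lt_le_trans q1.
(* The first constant comes from the single high point, the second from the [D] cuts, each of mass
   at most [4 ^+ D * T ^- d]. Both involve the field only through its order. *)
exists (q ^- (D.+1 ^ 2 + D)), (D%:R * 4 ^+ D); split.
- by rewrite invr_gt0 exprn_gt0.
- apply: (@le_trans _ _ 1); first by rewrite invf_le1 ?exprn_gt0 ?exprn_ege1.
  by rewrite -natrX -natrM ler1n muln_gt0 D_gt0 expn_gt0.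
move=> k cardk.
have nu_bounds (T : R) : 1 <= T ->
    ((q ^- (D.+1 ^ 2 + D) * T ^- D.+1)%:E <= nu R (superlevel k D.+1 T)
      <= (D%:R * 4 ^+ D * T ^- D.+1)%:E)%E.
  move=> T1; rewrite nu_superlevel_le // andbT.
  by have := @nu_superlevel_ge R k D D_gt0 T T1; rewrite cardk.
have := @nu_setT_bounds R k D D_gt0; split=> // T T1.
move: (nu_setT_bounds R k D_gt0); rewrite /mu.
(* The total mass is a positive real [v], so dividing by it is multiplication by the real number
   [v^-1]. *)
case: (nu R [set: Y k D.+1]) => [v| |]; rewrite ?ltxx ?andbF //.
rewrite lte_fin => /andP[v0 _].
have vi0 : (0 <= v^-1%:E)%E by rewrite lee_fin invr_ge0 ltW.
have /andP[lo hi] := nu_bounds T T1.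
rewrite inver gt_eqF //.
by rewrite -!EFinM ![_ * v^-1 * _]mulrAC !EFinM !lee_wpmul2r.
Qed.
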